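(* Let $A:\mathbb{U}^1\to\mathbb{R}$ be a Morse sc-action functional, let $x:\mathbb{R}\to\mathbb{U}$ be a (negative) sc-gradient flow line of $A$, and suppose that $\lim_{s\to+\infty}x(s)=x^+\in\mathrm{Crit}\,A$, where convergence is with respect to the $E_\infty$-topology. Let $a^+:=A(x^+)$ and let $\kappa>0$ be an action-energy constant at $x^+$, i.e. there is $\epsilon>0$ such that $|A(y)-a^+|\le \frac{e(y)}{\kappa}$ for all $y\in U_{10}$ with $\|y-x^+\|_{10}<\epsilon$. Let $0<\kappa'<\frac{\kappa}{3}$. Then there exist constants $C_{j,m}=C_{j,m}(\kappa')>0$, $j,m\in\mathbb{N}$, such that $$\|x(s)-x^+\|_j\le C_{j,0}\,e^{-\kappa' s}\qquad\forall s\ge 0$$ and $$\|x^{(m)}(s)\|_j\le C_{j,m}\,e^{-\kappa' s}\qquad\forall s\ge 0,\ m\ge 1,$$ where $x^{(m)}:=\frac{d^m x}{ds^m}$.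
   Context: $\mathbb{N}$ contains $0$. A sc-space $\mathbb{E}=(E_k)_{k\in\mathbb{N}}$ is a nested sequence of Banach spaces $E_0\supset E_1\supset E_2\supset\cdots$ such that each inclusion $E_{k+1}\hookrightarrow E_k$ is compact and dense; then $E_\infty:=\bigcap_k E_k$ is dense in every $E_k$. Throughout, each $E_k$ is a Hilbert space with norm $\|\cdot\|_k$, and $\langle\cdot,\cdot\rangle$ denotes the inner product of $E_0$. The $E_\infty$-topology is the one given by all norms $\|\cdot\|_k$: convergence in it means convergence in every $\|\cdot\|_k$. Put $\mathbb{E}^m:=(E_{k+m})_{k\in\mathbb{N}}$. Let $U\subset E_0$ be open, $U_k:=U\cap E_k$, $U_\infty:=U\cap E_\infty$, $\mathbb{U}:=(U_k)_{k\in\mathbb{N}}$, $\mathbb{U}^m:=(U_{k+m})_{k\in\mathbb{N}}$. $\mathbb{R}$ carries the constant scale structure. sc-smoothness (Hofer-Wysocki-Zehnder): a map $f:\mathbb{U}\to\mathbb{F}$ is $sc^0$ if $f(U_k)\subset F_k$ and $f:U_k\to F_k$ is continuous for all $k$. It is $sc^1$ if it is $sc^0$, for each $x\in U_1$ there is a bounded linear map $Df(x):E_0\to F_0$ with $\|f(x+h)-f(x)-Df(x)h\|_0/\|h\|_1\to0$ as $h\to0$ in $E_1$, and the tangent map $Tf:\mathbb{U}^1\oplus\mathbb{E}\to\mathbb{F}^1\oplus\mathbb{F}$, $Tf(x,h)=(f(x),Df(x)h)$, is $sc^0$. Inductively $f$ is $sc^{k+1}$ if $Tf$ is $sc^k$,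 and sc-smooth if $sc^k$ for all $k$. For maps on $\mathbb{U}^1$ all levels are shifted by one. A sc-action functional is a sc-smooth map $A:\mathbb{U}^1\to\mathbb{R}$ that admits a gradient, i.e. a sc-smooth map $\nabla A:\mathbb{U}^1\to\mathbb{E}$ (so $\nabla A(U_{k+1})\subset E_k$) with $\langle\nabla A(x),\xi\rangle=DA(x)\xi$ for all $x\in U_2$, $\xi\in E_1$. Its critical set is $\mathrm{Crit}\,A:=\{x\in U_\infty\mid DA(x)=0\}=\{x\in U_\infty\mid\nabla A(x)=0\}$. $A$ is Morse if for every $x\in\mathrm{Crit}\,A$ and every $k\ge0$ the Hessian $\mathscr{H}_A(x):=D\nabla A(x):E_{k+1}\to E_k$ is an isomorphism. The energy is $e(x):=\langle\nabla A(x),\nabla A(x)\rangle$. A (negative) sc-gradient flow line of $A$ is a sc-smooth map $x:\mathbb{R}\to\mathbb{U}$ with $x'(s)=-\nabla A(x(s))$ for all $s$, where $x'(s):=Dx(s)1$. (Since $\mathbb{R}$ has the constant scale structure, $x(\mathbb{R})\subset U_\infty$.) *)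

(* Defs.v *)
From HB Require Import structures.
From mathcomp Require Import all_boot all_order all_algebra.
From mathcomp Require Import all_classical all_reals all_analysis.

Set Implicit Arguments.
Unset Strict Implicit.
Unset Printing Implicit Defensive.

Import Order.TTheory GRing.Theory Num.Theory.
Import numFieldNormedType.Exports.

Local Open Scope classical_set_scope.
Local Open Scope ring_scope.

Section prod_complete.
Context {R : realType} (V W : completeNormedModType R).

HB.instance Definition _ := Pointed.copy (V * W)%type (V * W)%type.

Lemma prod_complete (F : set_system (V * W)) :
  ProperFilter F -> cauchy F -> cvg F.
Proof.
move=> FF /cauchy_ballP Fc.
have c1 : cvg (fst @ F).
  apply/cauchy_cvgP/cauchy_ballP => e e0.
  have [[P Q] [/= FP FQ] PQ] := Fc _ e0.
  exists (fst @` P, fst @` Q) => /=.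
    split; [apply: filterS FP|apply: filterS FQ] => p Pp /=; by exists p.
  by move=> [_ _] [/= [p Pp <-] [q Qq <-]]; have [] := PQ (p, q) (conj Pp Qq).
have c2 : cvg (snd @ F).
  apply/cauchy_cvgP/cauchy_ballP => e e0.
  have [[P Q] [/= FP FQ] PQ] := Fc _ e0.
  exists (snd @` P, snd @` Q) => /=.
    split; [apply: filterS FP|apply: filterS FQ] => p Pp /=; by exists p.
  by move=> [_ _] [/= [p Pp <-] [q Qq <-]]; have [] := PQ (p, q) (conj Pp Qq).
apply/cvg_ex; exists (lim (fst @ F), lim (snd @ F)).
have -> : F = ((fun p => (p.1, p.2)) @ F).
  by apply/seteqP; split => A /=; rewrite /nbhs /=; apply: filterS => -[].
exact: cvg_pair c1 c2.
Qed.

HB.instance Definition _ := Uniform_isComplete.Build (V * W)%type prod_complete.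

End prod_complete.

Definition compact_map (R : realType) (V W : normedModType R)
    (f : {linear V -> W}) :=
  continuous f /\
  (forall B : set V, bounded_set B -> precompact (f @` B)).

(* The chain E_0 ⊃ E_1 ⊃ ... is a sequence of Banach spaces together with the
   inclusions E_{k+1} -> E_k as injective linear maps. *)
Record scSpace (R : realType) := ScSpace {
  sc_level :> nat -> completeNormedModType R;
  sc_step : forall k, {linear sc_level k.+1 -> sc_level k};
  sc_step_inj : forall k, injective (sc_step k);
  sc_step_compact : forall k, compact_map (sc_step k);
  sc_step_dense : forall k, dense (range (sc_step k))
}.
Arguments sc_step {R} E k : rename.

Section sc_operations.
Context {R : realType}.

Lemma bounded_setP (V : normedModType R) (B : set V) :
  bounded_set B <-> exists M : R, forall x, B x -> `|x| <= M.
Proof.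
split=> [[M [_ MB]]|[M MB]].
  by exists (M + 1) => x Bx; apply: (MB (M + 1)) => //; rewrite ltrDl.
exists M; split; first exact: num_real.
by move=> N MN x Bx; exact: le_trans (MB _ Bx) (ltW MN).
Qed.

Lemma compact_map_id : @compact_map R R R idfun.
Proof.
split; first by move=> x; exact: cvg_id.
move=> B /bounded_setP[M Mbnd]; rewrite image_id.
exists (closed_ball (0 : R) (`|M| + 1)); last first.
  split; last exact: closed_ball_closed.
  by apply: closed_ballR_compact; rewrite ltr_wpDl.
move=> x Bx; rewrite closed_ballE ?ltr_wpDl// /closed_ball_/= sub0r normrN.
by rewrite (le_trans (Mbnd _ Bx))// (le_trans (ler_norm _))// lerDl.
Qed.

Lemma dense_range_id : dense (range (idfun : R -> R)).
Proof. by move=> O [x Ox] _; exists x; split => //; exists x. Qed.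

Definition scConst : scSpace R := @ScSpace R (fun=> R) (fun=> idfun)
  (fun _ _ _ => id) (fun=> compact_map_id) (fun=> dense_range_id).

(* E^1 = (E_{k+1})_k *)
Definition scShift (E : scSpace R) : scSpace R :=
  @ScSpace R (fun k => E k.+1) (fun k => sc_step E k.+1)
    (fun k => @sc_step_inj R E k.+1) (fun k => sc_step_compact E k.+1)
    (fun k => @sc_step_dense R E k.+1).

Section sum.
Variables E F : scSpace R.

Definition sum_step k (p : E k.+1 * F k.+1) : E k * F k :=
  (sc_step E k p.1, sc_step F k p.2).

Lemma sum_step_linear k : linear (@sum_step k).
Proof. by move=> a [x1 x2] [y1 y2]; rewrite /sum_step /= !linearP. Qed.

HB.instance Definition _ k := GRing.isLinear.Build R (E k.+1 * F k.+1)%type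
  (E k * F k)%type _ (@sum_step k) (@sum_step_linear k).

Lemma sum_step_inj k : injective (@sum_step k).
Proof. by move=> [x1 x2] [y1 y2] [/sc_step_inj -> /sc_step_inj ->]. Qed.

Lemma sum_step_compact k : compact_map (@sum_step k).
Proof.
have [cE pE] := sc_step_compact E k; have [cF pF] := sc_step_compact F k.
split=> [[x y]|B /bounded_setP[M Mbnd]].
  apply: cvg_pair.
    by apply: cvg_comp; [exact: cvg_fst|exact: cE].
  by apply: cvg_comp; [exact: cvg_snd|exact: cF].
have b1 : bounded_set (fst @` B).
  apply/bounded_setP; exists M => _ [[p q] Bpq <-].
  by have := Mbnd _ Bpq; apply: le_trans; rewrite [leRHS]/Num.norm/= le_max lexx.
have b2 : bounded_set (snd @` B).
  apply/bounded_setP; exists M => _ [[p q] Bpq <-].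
  by have := Mbnd _ Bpq; apply: le_trans; rewrite [leRHS]/Num.norm/= le_max lexx orbT.
have [K1 s1 [k1 c1]] := pE _ b1; have [K2 s2 [k2 c2]] := pF _ b2.
exists (K1 `*` K2); last first.
  split; first exact: compact_setX.
  have -> : K1 `*` K2 = (fst @^-1` K1) `&` (snd @^-1` K2) by [].
  by apply: closedI; apply: preimage_closed => // -[p q] _;
    [exact: cvg_fst|exact: cvg_snd].
move=> _ [[p q] Bpq <-]; split=> /=.
  by apply: s1; exists p => //; exists (p, q).
by apply: s2; exists q => //; exists (p, q).
Qed.

Lemma sum_step_dense k : dense (range (@sum_step k)).
Proof.
move=> O [[x y] Oxy] oO.
have [[A B] /= [Ax By] ABO] : nbhs (x, y) O by exact: open_nbhs_nbhs.
have [p [/= Ap [u _ up]]] := @sc_step_dense R E k A°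
  (ex_intro _ x Ax) (@open_interior _ A).
have [q [/= Bq [v _ vq]]] := @sc_step_dense R F k B°
  (ex_intro _ y By) (@open_interior _ B).
exists (p, q); split.
  by apply: ABO; split => /=; exact: interior_subset.
by exists (u, v) => //; rewrite /sum_step/= up vq.
Qed.

Definition scSum : scSpace R := @ScSpace R (fun k => (E k * F k)%type)
  (fun k => @sum_step k) sum_step_inj sum_step_compact sum_step_dense.

End sum.

Definition scTangent (E : scSpace R) : scSpace R := scSum (scShift E) E.

Fixpoint sc_incl (E : scSpace R) k : E k -> E 0%N :=
  match k with
  | 0%N => id
  | k'.+1 => fun x => sc_incl (sc_step E k' x)
  end.

(* E_k as a subset of E_0 *)
Definition sc_mem (E : scSpace R) k : set (E 0%N) := range (@sc_incl E k).

(* The element of E_0 seen as an element of E_k; only meaningful on E_k. *)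
Definition sc_lift (E : scSpace R) k (x : E 0%N) : E k :=
  xget 0 [set y | sc_incl y = x].

(* ||x||_k <= r, which includes that x lies in E_k *)
Definition sc_norm_le (E : scSpace R) k (x : E 0%N) (r : R) :=
  exists2 y : E k, sc_incl y = x & `|y| <= r.

Section sc_smoothness.

(* In the definitions below a map from U to F is a total function
   f : E 0 -> F 0 whose values off U are irrelevant. *)

Definition sc0 (E F : scSpace R) (U : set (E 0%N)) (f : E 0%N -> F 0%N) :=
  forall k,
    (forall x : E k, U (sc_incl x) -> sc_mem k (f (sc_incl x))) /\
    {within [set x : E k | U (sc_incl x)],
      continuous (fun x : E k => sc_lift k (f (sc_incl x)))}.

Definition is_scD (E F : scSpace R) (f : E 0%N -> F 0%N) (x : E 1%N)
    (D : {linear E 0%N -> F 0%N}) :=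
  continuous D /\
  (fun h : E 1%N =>
     `|f (sc_incl (x + h)) - f (sc_incl x) - D (sc_incl h)| / `|h|)
    @ (0 : E 1%N)^' --> (0 : R).

(* Df(x), for x in U_1; unique when it exists since E_1 is dense in E_0. *)
Definition scD (E F : scSpace R) (f : E 0%N -> F 0%N) (x : E 1%N) :
  {linear E 0%N -> F 0%N} := get (is_scD f x).

Definition sc_differentiable (E F : scSpace R) (U : set (E 0%N))
    (f : E 0%N -> F 0%N) :=
  forall x : E 1%N, U (sc_incl x) -> exists D, is_scD f x D.

(* U^1 as a subset of E_1 *)
Definition scdom_shift (E : scSpace R) (U : set (E 0%N)) :
  set (scShift E 0%N) := [set x : E 1%N | U (sc_incl x)].

Definition scdom_tangent (E : scSpace R) (U : set (E 0%N)) :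
  set (scTangent E 0%N) := [set p : E 1%N * E 0%N | U (sc_incl p.1)].

Definition sc_tangent (E F : scSpace R) (f : E 0%N -> F 0%N) :
    scTangent E 0%N -> scTangent F 0%N :=
  fun p : E 1%N * E 0%N =>
    (sc_lift 1 (f (sc_incl p.1)), scD f p.1 p.2).

Fixpoint scn (n : nat) (E F : scSpace R) (U : set (E 0%N))
    (f : E 0%N -> F 0%N) : Prop :=
  match n with
  | 0%N => sc0 U f
  | n'.+1 => [/\ sc0 U f, sc_differentiable U f &
                 scn n' (scdom_tangent U) (sc_tangent f)]
  end.

Definition sc_smooth (E F : scSpace R) (U : set (E 0%N))
    (f : E 0%N -> F 0%N) := forall n, scn n U f.

End sc_smoothness.

End sc_operations.

Record scHilbert (R : realType) := ScHilbert {
  sc_of_hilbert :> scSpace R;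
  sc_inner : forall k, {biscalar (sc_of_hilbert k)};
  sc_innerC : forall k x y, sc_inner k x y = sc_inner k y x;
  sc_inner_norm : forall k x, sc_inner k x x = `|x| ^+ 2
}.
Arguments sc_inner {R} E k : rename.

Section action_functionals.
Context {R : realType} (E : scHilbert R).

Section functional.
Variables (U : set (E 0%N)) (A : E 1%N -> R) (gradA : E 1%N -> E 0%N).

(* The derivative of A as a map on the scale E^1, at a point of E_2. *)
Definition dA (x : E 2%N) : {linear E 1%N -> R} :=
  @scD R (scShift E) (@scConst R) A x.

Definition is_gradient :=
  @sc_smooth R (scShift E) E (scdom_shift U) gradA /\
  forall (x : E 2%N) (xi : E 1%N), U (sc_incl x) ->
    sc_inner E 0 (gradA (sc_step E 1 x)) (sc_incl xi) = dA x xi.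

Definition sc_action_functional :=
  @sc_smooth R (scShift E) (@scConst R) (scdom_shift U) A /\ is_gradient.

Definition Crit : set (E 0%N) :=
  [set x | [/\ U x, forall k, sc_mem k x &
               forall xi : E 1%N, dA (sc_lift 2 x) xi = 0]].

Definition hessian (x : E 0%N) : {linear E 1%N -> E 0%N} :=
  @scD R (scShift E) E gradA (sc_lift 2 x).

(* H : E_1 -> E_0 restricts to an isomorphism of Banach spaces
   E_{k+1} -> E_k. *)
Definition restricts_to_iso (H : {linear E 1%N -> E 0%N}) (k : nat) :=
  exists (T : {linear E k.+1 -> E k}) (S : E k -> E k.+1),
    [/\ forall y : E k.+1, sc_incl (T y) = H (@sc_incl R (scShift E) k y),
        continuous T, continuous S, cancel T S & cancel S T].

Definition sc_Morse :=
  forall x, Crit x -> forall k, restricts_to_iso (hessian x) k.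

Definition energy (x : E 1%N) : R := sc_inner E 0 (gradA x) (gradA x).

Definition action_energy_constant (xp : E 0%N) (kappa : R) :=
  0 < kappa /\
  exists2 eps : R, 0 < eps &
    forall y : E 10%N, U (sc_incl y) -> `|y - sc_lift 10 xp| < eps ->
      let y1 : E 1%N := @sc_incl R (scShift E) 9 y in
      `|A y1 - A (sc_lift 1 xp)| <= energy y1 / kappa.

Definition sc_gradient_flow_line (x : R -> E 0%N) :=
  [/\ @sc_smooth R (@scConst R) E setT x,
      forall s, U (x s) &
      forall s, @scD R (@scConst R) E x s 1 = - gradA (sc_lift 1 (x s))].

End functional.

Definition sc_infty_cvg (x : R -> E 0%N) (xp : E 0%N) :=
  forall k, (fun s => sc_lift k (x s)) @ +oo --> sc_lift k xp.

End action_functionals.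

(* Main.v *)
Require Import Defs.
From HB Require Import structures.
From mathcomp Require Import all_boot all_order all_algebra.
From mathcomp Require Import all_classical all_reals all_analysis.
From mathcomp Require Import ring lra.

Set Implicit Arguments.
Unset Strict Implicit.
Unset Printing Implicit Defensive.

Import Order.TTheory GRing.Theory Num.Theory.
Import numFieldNormedType.Exports.

Local Open Scope classical_set_scope.
Local Open Scope ring_scope.

(** Write $\xi(s)=x(s)-x^+$ and let $H$ be the Hessian at $x^+$.

    At level 0 the decay comes from the action.  The gap $f=A(x(s))-a^+$ satisfies
    $f'=-e(x)=-\|x'\|_0^2$, it is nonnegative because it decreases to 0, and the
    action-energy inequality turns this into $f'\le-\kappa f$ for large $s$, so
    $f\le Ce^{-\kappa s}$.  Since $\sqrt f$ then decreases at least as fast as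
    $\frac{\sqrt\kappa}2\|x'\|_0$, the remaining length of the trajectory is at most
    $C\sqrt f$, whence $\|\xi(s)\|_0\le Ce^{-\kappa s/2}$
    ([flow_decay_bottom]).

    Climbing to the levels $E_j$ is a matter of interpolation.  $H$ is symmetric and,
    by the Morse condition, an isomorphism $E_{k+1}\to E_k$ for all $k$; hence the norm
    of $E_j$ is equivalent to $v\mapsto\|H^jv\|_0$ on $E_\infty$, and
    $\|H^jv\|_0^2=\langle v,H^{2j}v\rangle$ gives the interpolation inequality
    $\|v\|_j^2\le C\|v\|_0\|v\|_{2j}$ ([sc_interpolation]).  All $\|\xi\|_j$ are
    bounded, so one use of it gives the rate $\kappa/4$ at every level and a second
    use the rate $3\kappa/8>\kappa/3$ ([flow_decay_levels]).

    For the derivatives, $\nabla A$ vanishes at $x^+$ and is Lipschitz there as a map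
    $E_{k+2}\to E_k$ ([sc_lipschitz_at_zero]): this follows from the continuity of
    its tangent map, even though the derivative need not depend continuously on
    the base point in operator norm.  So $x'=-\nabla A(x)$ decays as fast as
    $\xi$, with a loss of levels that is harmless.  The tangent curve $(x,x')$
    solves the same kind of equation for the tangent map of $\nabla A$, with rest
    point $(x^+,0)$ and the same decay, so induction reaches all $x^{(m)}$
    ([flow_decay]).

    Smoothness of $x$ as a curve in every $E_k$ is extracted from
    sc-smoothness through iterated tangent maps ([is_derive_scD],
    [sc_smooth_comp_curve]), in place of integrating $E_k$-valued functions. *)

(** * Calculus of curves in normed spaces *)

Section calculus.
Context {R : realType}.
Implicit Types V W : normedModType R.

Lemma cvg_comp_at {T : Type} {V W} {F : set_system T} {FF : Filter F}
    (f : V -> W) (u : T -> V) (a : V) :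
  {for a, continuous f} -> u @ F --> a -> (fun t => f (u t)) @ F --> f a.
Proof. by move=> cf ua; exact: (cvg_comp u f ua cf). Qed.

Lemma near0P V (P : V -> Prop) :
  (\forall x \near (0 : V), P x) <->
  exists2 d : R, 0 < d & forall x, `|x| < d -> P x.
Proof. exact: nbhs_norm0P. Qed.

Lemma near_shift0 V (s : V) (P : V -> Prop) :
  (\forall x \near s, P x) -> \forall x \near (0 : V), P (x + s).
Proof.
move=> /nbhs_normP[d /= d0 Pd]; apply/near0P; exists d => // x xd.
by apply: Pd; rewrite /= distrC addrK.
Qed.

Lemma dnear0P V (P : V -> Prop) :
  (\forall x \near (0 : V)^', P x) <->
  exists2 d : R, 0 < d & forall x, `|x| < d -> x != 0 -> P x.
Proof.
split=> [|[d d0 H]]; first by move=> /near0P.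
by apply/near0P; exists d.
Qed.

Lemma is_derive_littleo V (c : R -> V) (s : R) (v : V) :
  is_derive s 1 c v <->
  forall e, 0 < e ->
    \forall t \near (0 : R), `|c (t + s) - c s - t *: v| <= e * `|t|.
Proof.
have E t : t != 0 ->
    `|t^-1 *: (c (t + s) - c s) - v| = `|c (t + s) - c s - t *: v| / `|t|.
  move=> t0; rewrite -[in LHS](scale1r v) -[in LHS](mulVf t0) -scalerA.
  by rewrite -scalerBr normrZ normfV mulrC.
split=> [[/cvg_ex[l cl] dl] e e0|H].
  have lv : l = v by rewrite -dl; apply/esym/cvg_lim.
  rewrite lv in cl.
  move/cvgrPdist_le : cl => /(_ _ e0); move=> /(@dnear0P R)[d d0 H].
  apply/(@near0P R); exists d => // t td.
  have [->|t0] := eqVneq t 0.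
    by rewrite add0r subrr scale0r subrr !normr0 mulr0.
  have := H t td t0; rewrite distrC /= [_ *: 1](mulr1 t).
  by rewrite E// ler_pdivrMr ?normr_gt0.
have C : (fun h : R => h^-1 *: ((c \o shift s) (h *: 1) - c s)) @ 0^' --> v.
  apply/cvgrPdist_le => e e0.
  have /(@near0P R)[d d0 {}H] := H _ e0.
  apply/(@dnear0P R); exists d => // t td t0.
  rewrite distrC /= [_ *: 1](mulr1 t) E// ler_pdivrMr ?normr_gt0//.
  exact: H.
by split; [apply/cvg_ex; exists v|exact/cvg_lim].
Qed.

Lemma is_derive_derive1 V (c : R -> V) (s : R) (v : V) :
  is_derive s 1 c v -> derive1 c s = v.
Proof. by move=> cv; rewrite derive1E derive_val. Qed.

Lemma is_derive_unique V (c : R -> V) (s : R) (v w : V) :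
  is_derive s 1 c v -> is_derive s 1 c w -> v = w.
Proof. by move=> /is_derive_derive1 <- /is_derive_derive1. Qed.

Lemma derivable_derive1 V (c : R -> V) (s : R) :
  derivable c s 1 -> is_derive s 1 c (derive1 c s).
Proof. by move=> ?; rewrite derive1E; apply: derivableP. Qed.

Lemma derivable_continuous V (c : R -> V) (s : R) :
  derivable c s 1 -> {for s, continuous c}.
Proof. by move=> /derivable1_diffP; exact: differentiable_continuous. Qed.

Lemma is_derive_continuous V (c : R -> V) (s : R) (v : V) :
  is_derive s 1 c v -> {for s, continuous c}.
Proof. by move=> -[+ _]; exact: derivable_continuous. Qed.

Lemma linear_bound V W (L : {linear V -> W}) : continuous L ->
  exists2 M : R, 0 < M & forall x, `|L x| <= M * `|x|.
Proof.
move=> /linear_bounded_continuous/linear_boundedP H.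
near (pinfty_nbhs R) => M; exists M; near: M; last exact: H.
exact: nbhs_pinfty_gt.
Unshelve. all: by end_near. Qed.

Lemma is_derive_linear V W (L : {linear V -> W}) (c : R -> V) (s : R) (v : V) :
  continuous L -> is_derive s 1 c v -> is_derive s 1 (fun t => L (c t)) (L v).
Proof.
move=> /linear_bound[M M0 LM] /is_derive_littleo cv; apply/is_derive_littleo.
move=> e e0; have := cv _ (divr_gt0 e0 M0).
apply: filterS => t H; rewrite -linearB -linearZ -linearB (le_trans (LM _))//.
by rewrite mulrC -ler_pdivlMr// mulrAC.
Qed.

Lemma norm_pair V W (v : V) (w : W) : `|(v, w)| = Num.max `|v| `|w|.
Proof. by []. Qed.

Lemma is_derive_pair V W (a : R -> V) (b : R -> W) (s : R) (v : V) (w : W) :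
  is_derive s 1 a v -> is_derive s 1 b w ->
  is_derive s 1 (fun t => (a t, b t) : V * W) ((v, w) : V * W).
Proof.
move=> /is_derive_littleo da /is_derive_littleo db; apply/is_derive_littleo.
move=> e e0; near=> t.
rewrite [X in `|X|](_ : _ = (a (t + s) - a s - t *: v, b (t + s) - b s - t *: w))//.
by rewrite norm_pair ge_max; apply/andP; split; near: t; [exact: da|exact: db].
Unshelve. all: by end_near. Qed.

(** The inverse [S] is a plain function here, so its boundedness is obtained from
    its continuity at 0 by rescaling arguments of [T]. *)
Lemma linear_inverse_bound V W (T : {linear V -> W}) (S : W -> V) :
  continuous S -> cancel T S -> cancel S T ->
  exists2 c : R, 0 < c & forall v, `|v| <= c * `|T v|.
Proof.
move=> cS TS ST; have S0 : S 0 = 0 by rewrite -(linear0 T) TS.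
have := cS 0; rewrite /continuous_at S0 => /cvgr0Pnorm_le/(_ _ ltr01).
move=> /near0P[d d0 Sd]; exists (2 / d); first by rewrite divr_gt0.
move=> v; have [Tv0|v0] := eqVneq (T v) 0.
  by rewrite -(TS v) Tv0 S0 linear0 !normr0 mulr0.
have Tv : 0 < `|T v| by rewrite normr_gt0.
have [a a0 ad] : exists2 a : R, 0 < a & a * `|T v| = d / 2.
  by exists (d / 2 / `|T v|); rewrite ?divr_gt0// divfK// gt_eqF.
have := Sd (T (a *: v)); rewrite TS linearZ !normrZ gtr0_norm// ad.
rewrite ltr_pdivrMr// ltr_pMr// ltr1n => /(_ isT) av.
rewrite -(ler_pM2l a0) (le_trans av)// mulrCA ad.
by rewrite le_eqVlt; apply/orP; left; apply/eqP; field; rewrite gt_eqF.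
Qed.

Lemma is_derive_fst V W (c : R -> V * W) (s : R) (p : V * W) :
  is_derive s 1 c p -> is_derive s 1 (fun t => (c t).1) p.1.
Proof.
move=> /is_derive_littleo cp; apply/is_derive_littleo => e e0.
apply: filterS (cp _ e0) => t; apply: le_trans.
by rewrite [leRHS]/Num.norm/= le_max lexx.
Qed.

Lemma is_derive_snd V W (c : R -> V * W) (s : R) (p : V * W) :
  is_derive s 1 c p -> is_derive s 1 (fun t => (c t).2) p.2.
Proof.
move=> /is_derive_littleo cp; apply/is_derive_littleo => e e0.
apply: filterS (cp _ e0) => t; apply: le_trans.
by rewrite [leRHS]/Num.norm/= le_max lexx orbT.
Qed.

Lemma derive1n_linear V W (L : {linear V -> W}) (c : R -> V) m :
  continuous L ->
  (forall i, (i < m)%N -> forall s, derivable (derive1n i c) s 1) ->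
  derive1n m (fun t => L (c t)) = (fun t => L (derive1n m c t)).
Proof.
move=> cL; elim: m => [//|m IH] dc; apply/funext => s.
rewrite derive1nS IH; last by move=> i im; apply: dc; exact: ltnW.
apply: is_derive_derive1; apply: is_derive_linear => //.
by apply: derivable_derive1; exact: dc.
Qed.

Lemma derive1n_pair V W (a : R -> V) (b : R -> W) m :
  (forall i, (i < m)%N -> forall s, derivable (derive1n i a) s 1) ->
  (forall i, (i < m)%N -> forall s, derivable (derive1n i b) s 1) ->
  derive1n m (fun t => (a t, b t) : V * W) =
  (fun t => (derive1n m a t, derive1n m b t)).
Proof.
elim: m => [//|m IH] da db; apply/funext => s; rewrite derive1nS IH.
- apply: is_derive_derive1; apply: is_derive_pair.
    by apply: derivable_derive1; exact: da.
  by apply: derivable_derive1; exact: db.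
- by move=> i im; apply: da; exact: ltnW.
- by move=> i im; apply: db; exact: ltnW.
Qed.

(** The bound with slack [e1] holds up to some largest time.  The derivatives there
    extend it a little further, so this time is [b]. *)
Lemma mean_value_inequality V (c dc : R -> V) (g dg : R -> R) (a b : R) :
  a <= b ->
  (forall t, a <= t <= b -> is_derive t 1 c (dc t)) ->
  (forall t, a <= t <= b -> is_derive t 1 g (dg t)) ->
  (forall t, a <= t <= b -> `|dc t| <= dg t) ->
  `|c b - c a| <= g b - g a.
Proof.
move=> ab Dc Dg cg; apply/ler_addgt0Pl => e e0.
have [e1 e10 e1e] : exists2 e1, 0 < e1 & e1 * (b - a) <= e.
  exists (e / (b - a + 1)); first by rewrite divr_gt0// ltr_wpDl// subr_ge0.
  rewrite mulrAC ler_pdivrMr ?ltr_wpDl ?subr_ge0// ler_wpM2l ?lerDl//.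
  exact: ltW.
rewrite (le_trans _ (_ : e1 * (b - a) + (g b - g a) <= _))//; last by rewrite lerD2r.
pose h t := `|c t - c a| - g t - e1 * t.
suff : h b <= h a by rewrite /h subrr normr0; nra.
pose S := [set t | a <= t <= b /\ h t <= h a].
have aS : S a by split; rewrite ?lexx ?ab.
have hS : has_sup S by split; [exists a|exists b => t [/andP[]]].
have am : a <= sup S by exact: sup_upper_bound.
have mb : sup S <= b by apply: ge_sup; [exists a|move=> t [/andP[]]].
have mab : a <= sup S <= b by rewrite am mb.
have hm : h (sup S) <= h a.
  have ch : {for sup S, continuous h}.
    apply: continuousB; last exact: continuousM (@cst_continuous _ _ _ _) _.
    apply: continuousB; last exact: is_derive_continuous (Dg _ mab).
    apply: (@continuous_comp _ _ _ (fun t => c t - c a) Num.norm).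
      apply: continuousB; last exact: cst_continuous.
      exact: is_derive_continuous (Dc _ mab).
    exact: norm_continuous.
  rewrite leNgt; apply/negP => hlt.
  have /nbhs_normP[d /= d0 Hd] : \forall t \near sup S, h a < h t.
    by move: ch => /cvgr_gt; apply.
  have [t St tm] := sup_adherent d0 hS.
  have := Hd t; rewrite /= ger0_norm ?subr_ge0; last exact: sup_upper_bound.
  by rewrite ltrBlDr addrC -ltrBlDr => /(_ tm); rewrite ltNge St.2.
have [bm|mltb] := leP b (sup S).
  by rewrite (_ : b = sup S)//; apply/le_anti; rewrite bm mb.
have e2 : 0 < e1 / 2 by rewrite divr_gt0.
have [d1 d10 H1] := (near0P _).1 ((is_derive_littleo _ _ _).1 (Dc _ mab) _ e2).
have [d2 d20 H2] := (near0P _).1 ((is_derive_littleo _ _ _).1 (Dg _ mab) _ e2).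
pose t := Num.min (Num.min d1 d2 / 2) (b - sup S).
have t0 : 0 < t by rewrite !lt_min subr_gt0 mltb !(divr_gt0, lt_min, d10, d20, ltr0n).
have td : t < Num.min d1 d2.
  rewrite (le_lt_trans (_ : _ <= Num.min d1 d2 / 2))// ?ge_min ?lexx//.
  by rewrite ltr_pdivrMr// ltr_pMr// ?ltr1n// lt_min d10.
have tb : t + sup S <= b by rewrite -lerBrDr ge_min lexx orbT.
have /H1 {}H1 : `|t| < d1 by rewrite gtr0_norm//; move: td; rewrite lt_min => /andP[].
have /H2 {}H2 : `|t| < d2 by rewrite gtr0_norm//; move: td; rewrite lt_min => /andP[].
suff : t + sup S <= sup S by rewrite gerDr leNgt t0.
apply: sup_upper_bound => //; split; first by rewrite tb andbT (le_trans am)// lerDr ltW.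
apply: le_trans hm; rewrite /h.
have : `|c (t + sup S) - c a| <=
    `|c (sup S) - c a| + `|c (t + sup S) - c (sup S) - t *: dc (sup S)| +
    t * `|dc (sup S)|.
  rewrite -[X in _ + X * _]gtr0_norm// -normrZ.
  apply: le_trans (lerD (ler_normD _ _) (lexx _)).
  apply: le_trans (ler_normD _ _).
  by rewrite -addrA (subrK (t *: dc (sup S))) [in leRHS]addrC addrA subrK.
move: H1 H2 (cg _ mab); rewrite gtr0_norm// ler_norml => H1 /andP[H2 _].
rewrite /GRing.scale/= in H2.
move: (`|c (t + sup S) - c (sup S) - _|) (`|dc _|) H1 H2 => A B *.
nra.
Qed.

Lemma le0_derive_nonincreasing (f df : R -> R) (a b : R) :
  a <= b ->
  (forall t, a <= t <= b -> is_derive t 1 f (df t)) ->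
  (forall t, a <= t <= b -> df t <= 0) ->
  f b <= f a.
Proof.
move=> ab Df df0.
have : `|(cst 0 : R -> R) b - cst 0 a| <= - f b - - f a.
  apply: (@mean_value_inequality R _ (cst 0) (- f) (- df)) => // t tab.
    by apply: is_deriveN; exact: Df.
  by rewrite normr0 [(- df) t](_ : _ = - df t)// oppr_ge0 df0.
by rewrite /= subrr normr0 opprK addrC subr_ge0.
Qed.

Lemma is_derive_expRM (k t : R) :
  is_derive t 1 (fun t => expR (k * t)) (k * expR (k * t)).
Proof.
have Dk : is_derive t 1 (fun t => k * t) k.
  apply/is_derive_littleo => e e0; near=> u.
  by rewrite mulrDr addrK /GRing.scale/= mulrC subrr normr0 mulr_ge0// ltW.
by rewrite mulrC; exact: (is_derive1_comp (is_derive_expR (k * t)) Dk).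
Unshelve. all: by end_near. Qed.

Lemma is_derive_sqrt (h : R -> R) (t dh : R) : 0 < h t -> is_derive t 1 h dh ->
  is_derive t 1 (fun t => Num.sqrt (h t)) (dh / (2 * Num.sqrt (h t))).
Proof.
move=> h0 Dh.
have hnear : \forall u \near t, 0 < h u.
  by move: (is_derive_continuous Dh) => /cvgr_gt; apply.
have -> : dh / (2 * Num.sqrt (h t)) = 2^-1 * h t `^ (2^-1 - 1) * dh.
  rewrite (_ : 2^-1 - 1 = - 2^-1 :> R); last by field.
  by rewrite powRN powR12_sqrt ?(ltW h0)// invfM mulrC.
apply: near_eq_is_derive (is_derive1_comp (is_derive1_powR _ h0) Dh).
near=> u; rewrite /= powR12_sqrt//; apply: ltW; near: u; exact: hnear.
Unshelve. all: by end_near. Qed.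

Lemma affine_derivable (a b : R) m (s : R) :
  derivable (derive1n m (fun t => a * t + b)) s 1.
Proof.
have D (a' b' t : R) : is_derive t 1 (fun t => a' * t + b') a'.
  apply/is_derive_littleo => e e0; near=> u.
  rewrite mulrDr opprD addrACA subrr addr0 addrK /GRing.scale/= mulrC subrr.
  by rewrite normr0 mulr_ge0// ltW.
suff [a' [b' ->]] : exists a' b', derive1n m (fun t => a * t + b) = fun t => a' * t + b'.
  by have [] := D a' b' s.
elim: m => [|m [a' [b' IH]]]; first by exists a, b.
exists 0, a'; rewrite derive1nS IH; apply/funext => t.
by rewrite (is_derive_derive1 (D a' b' t)) mul0r add0r.
Unshelve. all: by end_near. Qed.

Definition exp_decay (mu : R) V (u : R -> V) :=
  exists2 C : R, 0 < C & forall s, 0 <= s -> `|u s| <= C * expR (- mu * s).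

(** On the compact interval before the bound sets in, continuity suffices. *)
Lemma exp_decay_eventually (mu : R) V (u : R -> V) (C S : R) : continuous u ->
  (forall s, S <= s -> `|u s| <= C * expR (- mu * s)) -> exp_decay mu u.
Proof.
move=> cu uC; pose T := Num.max S 0.
have T0 : 0 <= T by rewrite le_max lexx orbT.
have cv : continuous (fun s => `|u s| * expR (mu * s)).
  move=> s; apply: cvgM.
    by apply: continuous_comp; [exact: cu|exact: norm_continuous].
  apply: continuous_comp; last exact: continuous_expR.
  exact: mulrl_continuous.
have [m _ mM] := EVT_max T0 (continuous_subspaceT cv).
exists (Num.max C (`|u m| * expR (mu * m)) + 1).
  by rewrite ltr_wpDl// le_max; apply/orP; right; rewrite mulr_ge0// expR_ge0.
move=> s s0; have [sT|Ts] := leP s T.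
  rewrite mulNr expRN -ler_pdivrMr ?invr_gt0 ?expR_gt0// invrK.
  rewrite (le_trans (mM s _)) ?in_itv/= ?s0//.
  by rewrite ler_wpDr// le_max lexx orbT.
rewrite (le_trans (uC _ _))//; first by rewrite (le_trans _ (ltW Ts))// le_max lexx.
by rewrite ler_wpM2r ?expR_ge0// ler_wpDr// le_max lexx.
Qed.

Lemma exp_small (mu C d : R) : 0 < mu -> 0 < d ->
  exists S, forall s, S <= s -> C * expR (- mu * s) < d.
Proof.
move=> mu0 d0; exists (C / (d * mu)) => s; rewrite ler_pdivrMr ?mulr_gt0// => Cs.
rewrite mulNr expRN ltr_pdivrMr ?expR_gt0// (le_lt_trans Cs)//.
rewrite mulrC -mulrA ltr_pM2l//.
by rewrite (lt_le_trans _ (expR_ge1Dx _))// ltrDr ltr01.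
Qed.

Lemma exp_decay_le (mu : R) V W (u : R -> V) (w : R -> W) M :
  (forall s, 0 <= s -> `|u s| <= M * `|w s|) ->
  exp_decay mu w -> exp_decay mu u.
Proof.
move=> uw [C C0 wC]; exists ((`|M| + 1) * C).
  by rewrite mulr_gt0// ltr_wpDl.
move=> s s0; rewrite (le_trans (uw _ s0))// -mulrA.
rewrite (le_trans (ler_wpM2r (normr_ge0 _) (_ : M <= `|M| + 1)))//.
  by rewrite ler_wpDr// ler_norm.
by rewrite ler_wpM2l ?wC// ler_wpDl.
Qed.

Lemma exp_decay_mean (V W X : normedModType R) (u : R -> V)
    (v : R -> W) (w : R -> X) (a b c : R) : 0 < c ->
  (forall s, 0 <= s -> `|u s| ^+ 2 <= c * (`|v s| * `|w s|)) ->
  exp_decay a v -> exp_decay b w -> exp_decay ((a + b) / 2) u.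
Proof.
move=> c0 uvw [C C0 vC] [D D0 wD]; exists (Num.sqrt (c * (C * D))).
  by rewrite sqrtr_gt0 !mulr_gt0.
move=> s s0; rewrite -ler_sqr ?nnegrE ?mulr_ge0 ?sqrtr_ge0 ?expR_ge0//.
rewrite (le_trans (uvw s s0))// exprMn sqr_sqrtr ?(ltW (mulr_gt0 c0 (mulr_gt0 C0 D0)))//.
rewrite -expRM_natl -mulrA ler_pM2l//.
rewrite (le_trans (ler_pM _ _ (vC s s0) (wD s s0)))// mulrACA -expRD.
rewrite ler_pM2l ?mulr_gt0// ler_expR le_eqVlt; apply/orP; left; apply/eqP.
by field.
Qed.

End calculus.

(** * Scales *)

Section scales.
Context {R : realType}.
Implicit Types E F : scSpace R.

Lemma sc_step_continuous E k : continuous (sc_step E k).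
Proof. by have [] := sc_step_compact E k. Qed.

Lemma sc_incl_linear E k : linear (@sc_incl R E k).
Proof. by elim: k => [//|k IH] a x y; rewrite /= linearP IH. Qed.

HB.instance Definition _ E k := GRing.isLinear.Build R (E k) (E 0%N) _
  (@sc_incl R E k) (@sc_incl_linear E k).

Lemma sc_inclN E k x : @sc_incl R E k (- x) = - sc_incl x.
Proof. exact: linearN. Qed.

Lemma sc_inclB E k x y : @sc_incl R E k (x - y) = sc_incl x - sc_incl y.
Proof. exact: linearB. Qed.

Lemma sc_inclZ E k (a : R) x : @sc_incl R E k (a *: x) = a *: sc_incl x.
Proof. exact: linearZ. Qed.

Lemma sc_incl_inj E k : injective (@sc_incl R E k).
Proof. by elim: k => [//|k IH] x y /= /IH/sc_step_inj. Qed.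

Lemma sc_incl_continuous E k : continuous (@sc_incl R E k).
Proof.
elim: k => [|k IH] x; first exact: cvg_id.
by apply: (cvg_comp_at (IH _)); exact: sc_step_continuous.
Qed.

Lemma sc_incl_shift E k (x : E k.+1) :
  sc_incl x = sc_step E 0 (@sc_incl R (scShift E) k x).
Proof. by elim: k x => [//|k IH] x /=; rewrite -IH. Qed.

Lemma sc_incl_sum E F k (p : scSum E F k) :
  @sc_incl R (scSum E F) k p = (sc_incl p.1, sc_incl p.2).
Proof. by elim: k p => [[]//|k IH] p /=; rewrite IH. Qed.

Lemma sc_inclK E k : cancel (@sc_incl R E k) (@sc_lift R E k).
Proof.
by move=> x; rewrite /sc_lift; case: xgetP => [y _ /sc_incl_inj//|/(_ x)/(_ erefl)].
Qed.

Lemma sc_liftK E k x : sc_mem k x -> sc_incl (@sc_lift R E k x) = x.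
Proof. by move=> [y _ <-]; rewrite sc_inclK. Qed.

Lemma sc_lift0 E x : @sc_lift R E 0 x = x.
Proof. exact: (@sc_inclK E 0). Qed.

Lemma sc_lift_zero E k : @sc_lift R E k 0 = 0.
Proof. by rewrite -[X in sc_lift _ X](linear0 (@sc_incl R E k)) sc_inclK. Qed.

Lemma sc_lift_step E k x : sc_mem k.+1 x ->
  sc_step E k (sc_lift k.+1 x) = sc_lift k x.
Proof. by move=> [y _ <-]; rewrite sc_inclK/= sc_inclK. Qed.

Lemma sc_lift_shift E k (x : E 0%N) : sc_mem k.+1 x ->
  @sc_lift R (scShift E) k (@sc_lift R E 1 x) = sc_lift k.+1 x.
Proof.
move=> [y _ <-]; rewrite sc_inclK sc_incl_shift.
by rewrite (@sc_inclK E 1) (@sc_inclK (scShift E)).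
Qed.

Lemma sc_mem_shift E k (x : E 0%N) : sc_mem k.+1 x ->
  @sc_mem R (scShift E) k (@sc_lift R E 1 x).
Proof.
by move=> [y _ <-]; exists y => //; rewrite sc_incl_shift (@sc_inclK E 1).
Qed.

Lemma open_scdom E k (U : set (E 0%N)) : open U ->
  open [set x : E k | U (sc_incl x)].
Proof. by apply: open_comp => x _; exact: sc_incl_continuous. Qed.

Lemma open_scdom_tangent E (U : set (E 0%N)) : open U -> open (scdom_tangent U).
Proof.
move=> oU; have := @open_scdom E 1 U oU.
apply: (@open_comp _ _ (fst : (E 1%N * E 0%N)%type -> E 1%N)).
by move=> ? _; exact: cvg_fst.
Qed.

End scales.

(** * The chain rule for sc-smooth maps at every level *)

Section sc_calculus.
Context {R : realType}.
Implicit Types E F : scSpace R.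

Lemma sc_mem_sum E F k a b :
  @sc_mem R (scSum E F) k (a, b) <-> sc_mem k a /\ sc_mem k b.
Proof.
split=> [[p _]|[[p _ <-] [q _ <-]]].
  by rewrite sc_incl_sum => -[<- <-]; split; [exists p.1|exists p.2].
by exists (p, q) => //; rewrite sc_incl_sum.
Qed.

Lemma sc_lift_sum E F k a b : sc_mem k a -> sc_mem k b ->
  @sc_lift R (scSum E F) k (a, b) = (sc_lift k a, sc_lift k b).
Proof.
move=> [p _ <-] [q _ <-]; apply: (@sc_incl_inj R (scSum E F)).
rewrite sc_liftK; first by rewrite sc_incl_sum/= !sc_liftK//; eexists.
by apply/sc_mem_sum; split; eexists.
Qed.

Lemma scn_sc0 n E F U (f : E 0%N -> F 0%N) : scn n U f -> sc0 U f.
Proof. by case: n => [//|n] []. Qed.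

Lemma scn_tangent_mem E F U (f : E 0%N -> F 0%N) k (x : E k.+1) (h : E k) :
  scn 1 U f -> U (sc_incl x) ->
  sc_mem k (scD f (@sc_incl R (scShift E) k x) (sc_incl h)).
Proof.
move=> [_ _ /(_ k)[Tf _]] Ux; have := Tf (x, h); rewrite sc_incl_sum.
rewrite /scdom_tangent/= -[sc_step E 0 _]sc_incl_shift => /(_ Ux).
by move=> /sc_mem_sum[].
Qed.

Lemma scn1 n E F U (f : E 0%N -> F 0%N) : scn n.+1 U f -> scn 1 U f.
Proof. by move=> [? ? /scn_sc0]. Qed.

Lemma scn_tangent_lift E F U (f : E 0%N -> F 0%N) k (x : E k.+1) (h : E k) :
  scn 1 U f -> U (sc_incl x) ->
  @sc_lift R (scTangent F) k
    (sc_tangent f (@sc_incl R (scShift E) k x, sc_incl h)) =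
  (sc_lift k.+1 (f (sc_incl x)),
   sc_lift k (scD f (@sc_incl R (scShift E) k x) (sc_incl h))).
Proof.
move=> f1 Ux; have fx : sc_mem k.+1 (f (sc_incl x)).
  by have [f0 _ _] := f1; exact: (f0 k.+1).1.
rewrite /sc_tangent [sc_incl _.1](_ : _ = sc_incl x); last first.
  by rewrite [RHS]sc_incl_shift.
rewrite sc_lift_sum/= ?sc_lift_shift//; first exact: (sc_mem_shift fx).
exact: (scn_tangent_mem _ f1 Ux).
Qed.

Lemma is_scD_littleo E F (f : E 0%N -> F 0%N) x D : is_scD f x D ->
  forall e, 0 < e -> exists2 d : R, 0 < d & forall h : E 1%N, `|h| < d ->
    `|f (sc_incl (x + h)) - f (sc_incl x) - D (sc_incl h)| <= e * `|h|.
Proof.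
move=> [_ fD] e e0; move/cvgr0Pnorm_le : fD => /(_ _ e0)/dnear0P[d d0 H].
exists d => // h hd; have [->|h0] := eqVneq h 0.
  by rewrite addr0 subrr linear0 linear0 subr0 !normr0 mulr0.
have := H h hd h0; rewrite normrM normfV !normr_id ler_pdivrMr//.
by rewrite normr_gt0.
Qed.

Lemma scD_spec E F U (f : E 0%N -> F 0%N) (x : E 1%N) :
  sc_differentiable U f -> U (sc_incl x) -> is_scD f x (scD f x).
Proof. by move=> df /df[D fD]; exact: (getPex (ex_intro _ D fD)). Qed.

Lemma is_derive_scD0 E F U (f : E 0%N -> F 0%N) (c : R -> E 1%N) (s : R) v :
  sc_differentiable U f -> U (sc_incl (c s)) -> is_derive s 1 c v ->
  is_derive s 1 (fun t => f (sc_incl (c t))) (scD f (c s) (sc_incl v)).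
Proof.
move=> df Us dc; have fD := scD_spec df Us; have [cD _] := fD.
have [N N0 DN] := linear_bound cD.
have [M M0 iM] := linear_bound (@sc_incl_continuous R E 1).
apply/is_derive_littleo => e e0.
have e1 : 0 < e / 2 / (`|v| + 1) by rewrite !divr_gt0// ltr_wpDl.
have [d d0 fd] := is_scD_littleo fD e1.
have e2 : 0 < Num.min 1 (e / 2 / (N * M)).
  by rewrite lt_min ltr01 !(divr_gt0, mulr_gt0).
have cd : \forall t \near (0 : R), `|c s - c (t + s)| < d.
  apply: (@near_shift0 R R s (fun t => `|c s - c t| < d)).
  by have /cvgrPdist_lt/(_ _ d0) := is_derive_continuous dc.
have /is_derive_littleo/(_ _ e2) := dc; apply: filterS2 cd.
move=> t; rewrite distrC => cd H; have := fd _ cd.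
rewrite [c s + _]addrC subrK; set Q := f (sc_incl (c (t + s))) => H1.
have H2 : `|c (t + s) - c s| <= (`|v| + 1) * `|t|.
  rewrite -[X in `|X|](subrK (t *: v)) (le_trans (ler_normD _ _))// normrZ.
  rewrite mulrDl addrC [`|v| * _]mulrC mul1r lerD2l (le_trans H)//.
  by rewrite ler_piMl// ge_min lexx.
have {H1 H2} H1 :
    `|Q - f (sc_incl (c s)) - scD f (c s) (sc_incl (c (t + s) - c s))| <= e / 2 * `|t|.
  rewrite (le_trans H1)// mulrAC ler_pdivrMr ?ltr_wpDl//.
  by rewrite -[leRHS]mulrA ler_pM2l ?divr_gt0// mulrC.
have H2 :
    `|scD f (c s) (sc_incl (c (t + s) - c s)) - t *: scD f (c s) (sc_incl v)| <= e / 2 * `|t|.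
  rewrite -linearZ -linearB -linearZ -linearB (le_trans (DN _))//.
  rewrite (le_trans (ler_wpM2l (ltW N0) (iM _)))// mulrA.
  rewrite (le_trans (ler_wpM2l (ltW (mulr_gt0 N0 M0)) H))// mulrA ler_wpM2r//.
  by rewrite mulrC -ler_pdivlMr ?mulr_gt0// ge_min lexx orbT.
rewrite [e]splitr mulrDl (le_trans _ (lerD H1 H2))//.
by rewrite (le_trans _ (ler_normD _ _))// addrA subrK.
Qed.

(** The Fréchet condition in the definition of $sc^1$ is only imposed on the bottom
    level.  At level [n] it comes from the [n]-fold tangent map, whose bottom
    level has $F_n$ as a component; the induction follows the curve $(c, 0)$. *)
Lemma is_derive_scD n E F U (f : E 0%N -> F 0%N) (c : R -> E n.+1) (s : R) v :
  open U -> scn n.+1 U f -> U (sc_incl (c s)) -> is_derive s 1 c v ->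
  is_derive s 1 (fun t => sc_lift n (f (sc_incl (c t))))
    (sc_lift n (scD f (@sc_incl R (scShift E) n (c s)) (sc_incl v))).
Proof.
elim: n E F U f c v => [|n IH] E F U f c v oU fn Us dc.
  rewrite sc_lift0 (_ : (fun t => _) = (fun t => f (sc_incl (c t)))).
    by have [_ df _] := fn; exact: (is_derive_scD0 df).
  by apply/funext => t; rewrite sc_lift0.
have [f0 df Tf] := fn; have f1 := scn1 fn.
(* the tangent map along (c, 0) has f o c as its first component *)
have dc' : is_derive s 1 (fun t => (c t, 0 : E n.+1)) (v, 0 : E n.+1).
  by apply: is_derive_pair.
have UE t : U (sc_incl (c t)) ->
    scdom_tangent U (@sc_incl R (scTangent E) n.+1 (c t, 0)).
  by rewrite sc_incl_sum /scdom_tangent/= -[sc_step E 0 _]sc_incl_shift.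
have Unear : \forall t \near s, U (sc_incl (c t)).
  have : (fun t => sc_incl (c t)) @ s --> sc_incl (c s).
    apply: (cvg_comp_at (@sc_incl_continuous R E _ _)).
    exact: is_derive_continuous dc.
  by move=> /(_ U); apply; exact: open_nbhs_nbhs.
have := IH (scTangent E) (scTangent F) _ (sc_tangent f) _ _
  (open_scdom_tangent oU) Tf (UE s Us) dc'.
move=> /is_derive_fst; set w := (X in is_derive _ _ _ X) => dw.
have {}dw : is_derive s 1 (fun t => sc_lift n.+1 (f (sc_incl (c t)))) w.
  apply: near_eq_is_derive dw.
  near=> t; rewrite sc_incl_sum.
  by rewrite (scn_tangent_lift _ f1)//; near: t.
(* the derivative found in F_n.+1 is identified after inclusion in F_0 *)
suff wE : @sc_incl R F n.+1 w = scD f (@sc_incl R (scShift E) n.+1 (c s)) (sc_incl v).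
  by move: dw; rewrite -(@sc_inclK R F n.+1 w) wE.
apply: (is_derive_unique (is_derive_linear (@sc_incl_continuous R F n.+1) dw)).
have dc1 := is_derive_linear (@sc_incl_continuous R (scShift E) n.+1) dc.
have := is_derive_scD0 df _ dc1; rewrite -!sc_incl_shift => /(_ Us).
apply: near_eq_is_derive.
near=> t; rewrite [RHS]sc_liftK; first by rewrite [in RHS]sc_incl_shift.
by apply: (f0 n.+1).1; near: t.
Unshelve. all: by end_near. Qed.

End sc_calculus.

(** * Curves that are smooth at every level *)

Section sc_curves.
Context {R : realType}.
Implicit Types E F : scSpace R.

(** A smooth curve in $E_\infty$, recorded as its versions in the spaces $E_k$. *)
Definition sc_smooth_curve E (c : forall k, R -> E k) :=
  (forall k s, sc_step E k (c k.+1 s) = c k s) /\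
  (forall m k s, derivable (derive1n m (c k)) s 1).

Definition curve_derive E (c : forall k, R -> E k) k : R -> E k := derive1 (c k).

Definition curve_tangent E (c : forall k, R -> E k) k : R -> scTangent E k :=
  fun s => (c k.+1 s, curve_derive c k s).

Section curve.
Variables (E : scSpace R) (c : forall k, R -> E k).
Hypothesis sc : sc_smooth_curve c.

Lemma curve_incl k s : sc_incl (c k s) = c 0%N s.
Proof. by have [st _] := sc; elim: k s => [//|k IH] s /=; rewrite st IH. Qed.

Lemma curve_incl_shift k s : @sc_incl R (scShift E) k (c k.+1 s) = c 1%N s.
Proof.
by apply: (@sc_step_inj R E 0); rewrite -sc_incl_shift curve_incl sc.1.
Qed.

Lemma curve_step_derive1n m k s :
  sc_step E k (derive1n m (c k.+1) s) = derive1n m (c k) s.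
Proof.
have [st dc] := sc; rewrite -(funext (st k)).
rewrite (derive1n_linear (L := sc_step E k))//; exact: sc_step_continuous.
Qed.

Lemma curve_incl_derive1n m k s :
  sc_incl (derive1n m (c k) s) = derive1n m (c 0%N) s.
Proof. by elim: k => [//|k IH] /=; rewrite curve_step_derive1n. Qed.

Lemma curve_derivable k s : derivable (c k) s 1.
Proof. exact: (sc.2 0%N). Qed.

Lemma curve_is_derive k (s : R) : is_derive s 1 (c k) (curve_derive c k s).
Proof. by apply: derivable_derive1; exact: curve_derivable. Qed.

Lemma curve_derive_smooth : sc_smooth_curve (curve_derive c).
Proof.
split=> [k s|m k s]; first exact: (curve_step_derive1n 1).
by rewrite -derive1Sn; exact: sc.2.
Qed.

Lemma derive1n_curve_tangent m k : derive1n m (curve_tangent c k) =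
  (fun s => (derive1n m (c k.+1) s, derive1n m.+1 (c k) s)).
Proof.
rewrite derive1Sn; apply: derive1n_pair => i _ s; first exact: sc.2.
exact: (curve_derive_smooth.2).
Qed.

Lemma curve_tangent_smooth : sc_smooth_curve (curve_tangent c).
Proof.
split=> [k s|m k s].
  by congr (_, _); [exact: sc.1|exact: curve_derive_smooth.1].
have d1 := derivable_derive1 (sc.2 m k.+1 s).
have d2 := derivable_derive1 (sc.2 m.+1 k s).
have [+ _] := is_derive_pair d1 d2.
by rewrite derive1n_curve_tangent.
Qed.

End curve.

(** Differentiating $f\circ c$ once gives the second component of $Tf\circ Tc$, so
    the regularity of all derivatives follows from that of the tangent maps. *)
Lemma sc_smooth_comp_curve E F U (f : E 0%N -> F 0%N) (c : forall k, R -> E k) :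
  open U -> sc_smooth U f -> sc_smooth_curve c -> (forall s, U (c 0%N s)) ->
  sc_smooth_curve (fun k s => sc_lift k (f (c 0%N s))).
Proof.
move=> oU fs sc Uc; split=> [k s|m].
  apply: sc_lift_step; rewrite -(curve_incl sc k.+1); apply: (fs 0%N k.+1).1.
  by rewrite (curve_incl sc).
suff H i : (i <= m)%N -> forall k s,
    derivable (derive1n i (fun s => sc_lift k (f (c 0%N s)))) s 1 by exact: H.
elim: m i E F U f c oU fs sc Uc => [|m IH] i E F U f c oU fs sc Uc.
  rewrite leqn0 => /eqP-> k s.
  have Us : U (sc_incl (c k.+1 s)) by rewrite (curve_incl sc).
  have [+ _] := is_derive_scD oU (fs k.+1) Us (curve_is_derive sc k.+1 s).
  by rewrite derive1n0; under eq_fun do rewrite (curve_incl sc).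
have D k (s : R) : is_derive s 1 (fun s => sc_lift k (f (c 0%N s)))
    (sc_lift k (scD f (c 1%N s) (curve_derive c 0 s))).
  have Us : U (sc_incl (c k.+1 s)) by rewrite (curve_incl sc).
  have := is_derive_scD oU (fs k.+1) Us (curve_is_derive sc k.+1 s).
  rewrite (curve_incl_shift sc) (curve_incl (curve_derive_smooth sc)).
  by under eq_fun do rewrite (curve_incl sc).
case: i => [_ k s|i im k s]; first by have [] := D k s.
have Tfs : sc_smooth (scdom_tangent U) (sc_tangent f).
  by move=> n; have [] := fs n.+1.
have TU s' : scdom_tangent U (curve_tangent c 0 s').
  by rewrite /scdom_tangent/= sc.1.
have dT j := IH j _ _ _ _ _ (open_scdom_tangent oU) Tfs (curve_tangent_smooth sc) TU.
have -> : derive1n i.+1 (fun s => sc_lift k (f (c 0%N s))) = derive1n i (fun s =>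
    (@sc_lift R (scTangent F) k (sc_tangent f (curve_tangent c 0 s))).2).
  rewrite derive1Sn; congr derive1n; apply/funext => s'.
  rewrite (is_derive_derive1 (D k s')) /curve_tangent.
  have Us : U (sc_incl (c k.+1 s')) by rewrite (curve_incl sc).
  rewrite -(curve_incl_shift sc k) -(curve_incl (curve_derive_smooth sc) k).
  by rewrite (scn_tangent_lift _ (fs 1%N)).
rewrite (derive1n_linear (L := snd)).
- have := derivable_derive1 (dT i im k s).
  by move=> /is_derive_snd[].
- by move=> ?; exact: cvg_snd.
- by move=> j ji s'; apply: dT; rewrite (leq_trans (ltnW ji)).
Qed.

End sc_curves.

(** * Decay of derivatives along a flow *)

Section flows.
Context {R : realType}.
Implicit Types E F P Q : scSpace R.

(** Continuity of the tangent map at $(p,0)$ bounds $Df(w)h$ in $F_k$ by 1 for all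
    [w] near [p] in $E_{k+1}$ and all small [h] in $E_k$.  The mean value inequality is
    applied on the segment from [p] to [w], run through by a parameter for
    which the velocity is such a small [h]. *)
Lemma sc_lipschitz_at_zero E F U (f : E 0%N -> F 0%N) k (p : E k.+1) :
  open U -> sc_smooth U f -> U (sc_incl p) -> f (sc_incl p) = 0 ->
  exists2 M : R, 0 < M & \forall w \near p,
    `|sc_lift k (f (sc_incl w))| <= M * `|w - p|.
Proof.
move=> oU fs Up fp.
have /(_ k)[_] : sc0 (scdom_tangent U) (sc_tangent f) by have [_ _] := fs 1%N.
rewrite continuous_open_subspace; last first.
  by apply: open_scdom; exact: open_scdom_tangent.
move=> /(_ (p, 0)).
have TU (w : E k.+1) (h : E k) : U (sc_incl w) ->
    scdom_tangent U (@sc_incl R (scTangent E) k (w, h)).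
  by move=> Uw; rewrite sc_incl_sum /scdom_tangent/= -[sc_step E 0 _]sc_incl_shift.
move=> /(_ (mem_set (TU p 0 Up))).
rewrite /continuous_at => /cvgrPdist_le/(_ _ ltr01)/nbhs_normP[d /= d0 Hd].
have {}Hd (w : E k.+1) (h : E k) : U (sc_incl w) -> `|w - p| < d -> `|h| < d ->
    `|sc_lift k (scD f (@sc_incl R (scShift E) k w) (sc_incl h))| <= 1.
  move=> Uw wp hd; have := Hd (w, h).
  rewrite /= distrC !sc_incl_sum.
  rewrite !(scn_tangent_lift _ (fs 1%N))// linear0 linear0.
  rewrite sc_lift_zero.
  rewrite (_ : `|_ - _| = Num.max `|w - p| `|h - 0|)//.
  rewrite subr0 gt_max wp hd => /(_ isT).
  rewrite distrC [X in X <= _](_ : _ = Num.max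
    `|sc_lift k.+1 (f (sc_incl w)) - sc_lift k.+1 (f (sc_incl p))|
    `|sc_lift k (scD f (@sc_incl R (scShift E) k w) (sc_incl h)) - 0|)//.
  by rewrite subr0 ge_max => /andP[].
have [N N0 NE] := linear_bound (@sc_step_continuous R E k).
have /nbhs_normP[d1 /= d10 Hd1] : \forall w \near p, U (sc_incl w).
  by apply: open_nbhs_nbhs; split; [exact: open_scdom|].
have [rho rho0 Nrho] : exists2 rho, 0 < rho & N * rho < d.
  exists (d / (2 * N)); first by rewrite divr_gt0// mulr_gt0.
  by rewrite mulrA ltr_pdivrMr ?mulr_gt0//; nra.
exists rho^-1; first by rewrite invr_gt0.
apply/nbhs_normP; exists (Num.min d d1); first by rewrite /= lt_min d0.
move=> w /=; rewrite distrC; set xi := w - p => xid.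
have [xi0|xi0] := eqVneq xi 0.
  rewrite xi0 normr0 mulr0 (_ : w = p); last by apply/subr0_eq.
  by rewrite fp sc_lift_zero normr0.
have nxi : 0 < `|xi| by rewrite normr_gt0.
pose eta := (rho / `|xi|) *: xi.
have neta : `|eta| = rho.
  by rewrite normrZ gtr0_norm ?divr_gt0// divfK// gt_eqF.
have setad : `|sc_step E k eta| < d.
  by rewrite (le_lt_trans (NE _))// neta.
pose T := `|xi| / rho.
pose c (t : R) := p + t *: eta.
have cd t : 0 <= t <= T -> `|c t - p| < Num.min d d1.
  move=> /andP[t0 tT]; rewrite /c addrC addKr normrZ neta ger0_norm//.
  by rewrite (le_lt_trans _ xid)// -ler_pdivlMr.
have Uc t : 0 <= t <= T -> U (sc_incl (c t)).
  by move=> /cd; rewrite lt_min => /andP[_ ct]; apply: Hd1; rewrite /= distrC.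
have dc (t : R) : is_derive t 1 c eta.
  by apply/is_derive_littleo => e e0; near=> u; rewrite /c scalerDl opprD
    addrACA subrr add0r addrK subrr normr0 mulr_ge0// ltW.
have : `|sc_lift k (f (sc_incl (c T))) - sc_lift k (f (sc_incl (c 0)))| <= T - 0.
  apply: (@mean_value_inequality R _ (fun t => sc_lift k (f (sc_incl (c t))))
    (fun t => sc_lift k (scD f (@sc_incl R (scShift E) k (c t)) (sc_incl eta)))
    id (cst 1)).
  - by rewrite divr_ge0// ltW.
  - by move=> t tT; exact: (is_derive_scD oU (fs k.+1) (Uc t tT) (dc t)).
  - move=> t tT; apply: Hd => //; first exact: Uc.
    by have := cd t tT; rewrite lt_min => /andP[].
have -> : c 0 = p by rewrite /c scale0r addr0.
have -> : c T = w.
  by rewrite /c /eta scalerA mulrA divfK ?gt_eqF// divff ?gt_eqF// scale1r addrC subrK.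
by rewrite fp sc_lift_zero !subr0 [rho^-1 * _]mulrC.
Unshelve. all: by end_near. Qed.

End flows.

Section flow_decay.
Context {R : realType}.
Implicit Types P Q : scSpace R.

(** A flow $z'=-F(y)$ on [Q] whose right-hand side is evaluated on a curve [y] of a
    second scale: in the application [P] is [Q] shifted by one and [y] is [z] seen
    one level higher.  [scTangent (scShift E)] and [scShift (scTangent E)] have the
    same levels but are not convertible, so requiring [P] to be a shift would not pass
    to tangents; the comparison of norms [level_shift] does. *)
Record flow P Q (V : set (P 0%N)) (F : P 0%N -> Q 0%N) (y : forall k, R -> P k)
    (z : forall k, R -> Q k) (p : forall k, P k) : Prop := Flow {
  flow_open : open V;
  flow_smooth : sc_smooth V F;
  flow_y : sc_smooth_curve y;
  flow_z : sc_smooth_curve z;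
  flow_dom : forall s, V (y 0%N s);
  flow_ode : forall s, curve_derive z 0 s = - F (y 0%N s);
  flow_rest_step : forall k, sc_step P k (p k.+1) = p k;
  flow_rest_dom : V (p 0%N);
  flow_rest : F (p 0%N) = 0;
  level_shift : forall m k s,
    `|derive1n m.+1 (y k) s| <= `|derive1n m.+1 (z k.+1) s|
}.

Lemma flow_velocity_decay P Q V F y z p (mu : R) k : 0 < mu ->
  @flow P Q V F y z p -> (forall k, exp_decay mu (fun s => y k s - p k)) ->
  exp_decay mu (curve_derive z k).
Proof.
move=> mu0 [oV sF sy sz yV ode ps pV Fp _] yp.
have pk j : sc_incl (p j) = p 0%N by elim: j => [//|j IH] /=; rewrite ps.
have [M M0] : exists2 M : R, 0 < M & \forall w \near p k.+1,
    `|sc_lift k (F (sc_incl w))| <= M * `|w - p k.+1|.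
  by apply: (sc_lipschitz_at_zero oV); rewrite ?pk.
move=> /nbhs_normP[d /= d0 Fd].
have [C C0 yC] := yp k.+1; have [S HS] := exp_small C mu0 d0.
apply: (@exp_decay_eventually _ _ _ _ (M * C) (Num.max S 0)).
  by move=> s; apply: derivable_continuous; exact: (sz.2 1%N).
move=> s; rewrite ge_max => /andP[Ss s0].
have -> : curve_derive z k s = - sc_lift k (F (sc_incl (y k.+1 s))).
  apply: (@sc_incl_inj _ _ k); rewrite sc_inclN sc_liftK; last first.
    rewrite (curve_incl sy) -(curve_incl sy k).
    by apply: (sF 0%N k).1; rewrite (curve_incl sy).
  by rewrite (curve_incl (curve_derive_smooth sz)) (curve_incl sy) ode.
rewrite normrN -mulrA (le_trans (Fd _ _))//.
  by rewrite /= distrC (le_lt_trans (yC s s0))// HS.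
by rewrite ler_wpM2l ?yC// ltW.
Qed.

(** The second component of the tangent equation is the equation of the flow
    differentiated in time, which only takes the chain rule at level 0. *)
Lemma flow_tangent P Q V F y z p : @flow P Q V F y z p ->
  @flow (scTangent P) (scTangent Q) (scdom_tangent V) (sc_tangent F)
    (curve_tangent y) (curve_tangent z) (fun k => (p k.+1, 0)).
Proof.
move=> [oV sF sy sz yV ode ps pV Fp ls]; split.
- exact: open_scdom_tangent.
- by move=> n; have [] := sF n.+1.
- exact: curve_tangent_smooth.
- exact: curve_tangent_smooth.
- by move=> s; rewrite /scdom_tangent/= sy.1.
- move=> s.
  have sz' := curve_derive_smooth sz; have sy' := curve_derive_smooth sy.
  have -> : curve_derive (curve_tangent z) 0 s =
      (curve_derive z 1 s, curve_derive (curve_derive z) 0 s).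
    exact: (congr1 (@^~ s) (derive1n_curve_tangent sz 1 0)).
  have E1 : @sc_incl R P 1 (y 1%N s) = y 0%N s by rewrite (curve_incl sy).
  have Vs : V (@sc_incl R P 1 (y 1%N s)) by rewrite E1.
  rewrite /curve_tangent /sc_tangent E1.
  congr (_, _).
    apply: (@sc_incl_inj _ _ 1%N); rewrite sc_inclN sc_liftK; last first.
      rewrite -E1; exact: (sF 0%N 1%N).1.
    by rewrite (curve_incl sz') ode.
  have [_ dF _] := sF 1%N.
  have := is_derive_scD0 dF Vs (curve_is_derive sy 1 s).
  rewrite (curve_incl sy'); under eq_fun do rewrite (curve_incl sy).
  move=> dFy; rewrite -[LHS]/(derive1 (curve_derive z 0) s) (funext ode).
  exact: is_derive_derive1.
- by move=> k; exact: (congr2 pair (ps k.+1) (linear0 (sc_step P k))).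
- by rewrite /scdom_tangent/= ps.
- by rewrite /sc_tangent /= ps Fp linear0 sc_lift_zero.
- move=> m k s; rewrite !derive1n_curve_tangent//.
  rewrite !norm_pair ge_max !le_max.
  by apply/andP; split; apply/orP; [left|right]; exact: ls.
Qed.

(** Induction on [m] over all flows at once: the tangent flow decays at the same
    rate, and the second component of a derivative of the tangent curve is a
    derivative of [z] of one order more. *)
Lemma flow_decay P Q V F y z p (mu : R) m k : 0 < mu ->
  @flow P Q V F y z p -> (forall k, exp_decay mu (fun s => y k s - p k)) ->
  exp_decay mu (derive1n m.+1 (z k)).
Proof.
move=> mu0; elim: m P Q V F y z p k => [|m IH] P Q V F y z p k fl yp.
  exact: flow_velocity_decay fl yp.
have := IH _ _ _ _ _ _ _ k (flow_tangent fl).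
rewrite (derive1n_curve_tangent (flow_z fl)).
have yp' j : exp_decay mu (fun s => curve_tangent y j s - (p j.+1, 0)).
  have [C1 C10 y1] := yp j.+1.
  have [C2 C20 z1] := flow_velocity_decay j.+1 mu0 fl yp.
  exists (Num.max C1 C2); first by rewrite lt_max C10.
  move=> s s0; rewrite (_ : _ - _ = (y j.+1 s - p j.+1, curve_derive y j s)).
    rewrite norm_pair ge_max; apply/andP; split.
      by rewrite (le_trans (y1 s s0))// ler_wpM2r ?expR_ge0// le_max lexx.
    rewrite (le_trans (level_shift fl 0 j s))// (le_trans (z1 s s0))//.
    by rewrite ler_wpM2r ?expR_ge0// le_max lexx orbT.
  by congr (_, _); rewrite subr0.
move=> /(_ yp'); apply: exp_decay_le (1 : R) _ => s s0.
by rewrite mul1r norm_pair le_max lexx orbT.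
Qed.

End flow_decay.

(** * Symmetry of the Hessian *)

Section hilbert.
Context {R : realType} (E : scHilbert R).

Lemma sc_innerNl k x z : sc_inner E k (- x) z = - sc_inner E k x z.
Proof. exact: linearNl. Qed.

Lemma sc_innerBl k x y z :
  sc_inner E k (x - y) z = sc_inner E k x z - sc_inner E k y z.
Proof. exact: linearBl. Qed.

Lemma sc_innerZl k a x z : sc_inner E k (a *: x) z = a * sc_inner E k x z.
Proof. exact: linearZl_LR. Qed.

Lemma sc_innerNr k x z : sc_inner E k x (- z) = - sc_inner E k x z.
Proof. by rewrite sc_innerC sc_innerNl sc_innerC. Qed.

Lemma sc_innerBr k x y z :
  sc_inner E k z (x - y) = sc_inner E k z x - sc_inner E k z y.
Proof. by rewrite sc_innerC sc_innerBl !(sc_innerC _ z). Qed.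

Lemma sc_innerZr k a x z : sc_inner E k z (a *: x) = a * sc_inner E k z x.
Proof. by rewrite sc_innerC sc_innerZl sc_innerC. Qed.

Lemma sc_cauchy_schwarz k x y : `|sc_inner E k x y| <= `|x| * `|y|.
Proof.
have [->|y0] := eqVneq y 0.
  by rewrite -(scale0r 0) sc_innerZr mul0r normr0 scale0r normr0 mulr0.
have ny : 0 < `|y| by rewrite normr_gt0.
rewrite -ler_sqr ?nnegrE ?mulr_ge0// exprMn real_normK ?num_real//.
set b := sc_inner E k x y.
have : 0 <= sc_inner E k (x - (b / `|y| ^+ 2) *: y) (x - (b / `|y| ^+ 2) *: y).
  by rewrite sc_inner_norm sqr_ge0.
rewrite sc_innerBl !sc_innerBr !sc_innerZl !sc_innerZr (sc_innerC y x) -/b.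
rewrite !sc_inner_norm divfK ?sqrf_eq0 ?gt_eqF// subrr subr0 subr_ge0.
by rewrite mulrAC -expr2 ler_pdivrMr ?exprn_gt0.
Qed.

(** Vectors of $E_1$ approximate [g] itself. *)
Lemma sc_inner_dense (g : E 0%N) :
  (forall xi : E 1%N, sc_inner E 0 g (sc_incl xi) = 0) -> g = 0.
Proof.
move=> g0; apply/eqP; rewrite -normr_eq0; apply/eqP/le_anti; rewrite normr_ge0 andbT.
apply/ler_addgt0Pl => e e0; rewrite addr0.
have [w [/= xie [xi _ xiE]]] := @sc_step_dense R E 0 _
  (ex_intro _ g (ballxx g e0)) (@ball_open _ _ g e).
rewrite leNgt; apply/negP => eg.
have : `|g| ^+ 2 <= `|g| * e.
  rewrite -sc_inner_norm -[sc_inner E 0 g g]subr0 -(g0 xi) -sc_innerBr.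
  rewrite (le_trans (ler_norm _))// (le_trans (sc_cauchy_schwarz _ _))//.
  rewrite ler_wpM2l// ltW//; move: xie.
  by rewrite -xiE -[X in X -> _]/(ball g e _) -ball_normE.
by rewrite expr2 ler_pM2l ?(lt_trans e0)// leNgt eg.
Qed.

End hilbert.

Section hessian.
Context {R : realType} (E : scHilbert R).
Variables (U : set (E 0%N)) (A : E 1%N -> R) (gradA : E 1%N -> E 0%N).
Hypothesis openU : open U.
Hypothesis hA : sc_action_functional U A gradA.

Lemma action_is_derive (c : R -> E 2%N) (s : R) v :
  U (sc_incl (c s)) -> is_derive s 1 c v ->
  is_derive s 1 (fun t => A (sc_step E 1 (c t)))
    (sc_inner E 0 (gradA (sc_step E 1 (c s))) (sc_incl v)).
Proof.
move=> Us dc; have [As [_ Ag]] := hA; have [_ dA _] := As 1%N.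
rewrite (Ag _ (sc_step E 1 v))//.
exact: (@is_derive_scD0 R (scShift E) (@scConst R) _ _ _ _ _ dA).
Qed.

Lemma gradA_littleo (x : E 2%N) : U (sc_incl x) ->
  forall e, 0 < e -> exists2 d : R, 0 < d & forall h : E 2%N, `|h| < d ->
    `|gradA (sc_step E 1 (x + h)) - gradA (sc_step E 1 x)
      - @scD R (scShift E) E gradA x (sc_step E 1 h)| <= e * `|h|.
Proof.
move=> Ux; have [_ [gs _]] := hA; have [_ dg _] := gs 1%N.
exact: (@is_scD_littleo R (scShift E) E _ _ _ (scD_spec dg Ux)).
Qed.

(* A(x+t xi+t eta) - A(x+t xi) - A(x+t eta) + A(x), up to the order of xi, eta *)
Local Notation second_difference x t xi eta :=
  (A (sc_step E 1 (x + t *: xi + t *: eta)) - A (sc_step E 1 (x + t *: xi))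
   - (A (sc_step E 1 (x + t *: eta)) - A (sc_step E 1 x))).

(** The mean value inequality in the direction [xi] reduces the second difference of
    [A] to a first difference of the gradient in the direction [eta]; so the
    differentiability of the gradient at the single point [x] is enough. *)
Lemma second_difference_littleo (x xi eta : E 2%N) : U (sc_incl x) ->
  forall e, 0 < e -> exists2 d : R, 0 < d & forall t, 0 < t < d ->
    `|second_difference x t xi eta - t ^+ 2 *
      sc_inner E 0 (@scD R (scShift E) E gradA x (sc_step E 1 eta)) (sc_incl xi)|
    <= e * t ^+ 2.
Proof.
move=> Ux e e0; set D := scD _ _.
pose N := `|xi| + `|xi| + `|eta| + 1.
have N0 : 0 < N by rewrite ltr_wpDl.
pose M := `|@sc_incl R E 2 xi| + 1.
have M0 : 0 < M by rewrite ltr_wpDl.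
have [d d0 gd] := gradA_littleo Ux (divr_gt0 e0 (mulr_gt0 N0 M0)).
have /nbhs_normP[d1 /= d10 Ud] : \forall w \near x, U (sc_incl w).
  by apply: open_nbhs_nbhs; split; [exact: open_scdom|].
exists (Num.min d d1 / N); first by rewrite divr_gt0// lt_min d0.
move=> t /andP[t0]; rewrite ltr_pdivlMr// lt_min => /andP[td td1].
have hN (r : R) (b : bool) : 0 <= r <= 1 ->
    `|(r * t) *: xi + (if b then t *: eta else 0)| <= t * (`|xi| + (if b then `|eta| else 0)).
  move=> /andP[r0 r1]; rewrite (le_trans (ler_normD _ _))// mulrDr lerD//.
    by rewrite normrZ ger0_norm ?mulr_ge0 ?(ltW t0)// ler_wpM2r// ger_pMl.
  by case: b; rewrite ?normr0 ?mulr0// normrZ gtr0_norm.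
have hNd (r : R) (b : bool) : 0 <= r <= 1 ->
    `|(r * t) *: xi + (if b then t *: eta else 0)| < t * N.
  move=> r01; rewrite (le_lt_trans (hN r b r01))// ltr_pM2l// /N.
  have := normr_ge0 xi; have := normr_ge0 eta; case: b; lra.
(* two parallel segments in the direction xi, at distance t eta from each other *)
pose c b (r : R) := x + ((r * t) *: xi + (if b then t *: eta else 0)).
have Uc b r : 0 <= r <= 1 -> U (sc_incl (c b r)).
  move=> r01; apply: Ud; rewrite /= /c opprD addNKr normrN.
  exact: lt_trans (hNd r b r01) td1.
have dc b (r : R) : is_derive r 1 (c b) (t *: xi).
  apply/is_derive_littleo => eps eps0; near=> u.
  rewrite /c opprD addrACA subrr add0r opprD addrACA subrr addr0.
  by rewrite -scalerBl scalerA -scalerBl mulrDl addrK subrr scale0r normr0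
    mulr_ge0// ltW.
pose q := sc_inner E 0 (D (sc_step E 1 eta)) (sc_incl xi).
pose phi (r : R) := A (sc_step E 1 (c true r)) - A (sc_step E 1 (c false r))
  - r * (t ^+ 2 * q).
have Dk (k r : R) : is_derive r 1 (fun r => r * k) k.
  apply/is_derive_littleo => eps eps0; near=> u.
  by rewrite -mulrBl addrK /GRing.scale/= subrr normr0 mulr_ge0// ltW.
have : `|phi 1 - phi 0| <= 1 * (e * t ^+ 2) - 0 * (e * t ^+ 2).
  apply: (@mean_value_inequality R _ phi
    (fun r => sc_inner E 0 (gradA (sc_step E 1 (c true r))) (sc_incl (t *: xi))
      - sc_inner E 0 (gradA (sc_step E 1 (c false r))) (sc_incl (t *: xi))
      - t ^+ 2 * q)
    (fun r => r * (e * t ^+ 2)) (cst (e * t ^+ 2))) => // r r01.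
    apply: is_deriveB; apply: is_deriveB; apply: action_is_derive => //; exact: Uc.
  rewrite -sc_innerBl sc_inclZ sc_innerZr.
  pose h b := (r * t) *: xi + (if b then t *: eta else 0).
  have h12 : t *: D (sc_step E 1 eta) =
      D (sc_step E 1 (h true)) - D (sc_step E 1 (h false)).
    by rewrite -linearB -linearB /h addr0 addrC addKr !linearZ.
  have H1 b : `|gradA (sc_step E 1 (c b r)) - gradA (sc_step E 1 x)
      - D (sc_step E 1 (h b))|
      <= e / (N * M) * (t * (`|xi| + (if b then `|eta| else 0))).
    rewrite (le_trans (gd _ (lt_trans (hNd r b r01) td)))//.
    by rewrite ler_wpM2l ?hN// ltW// divr_gt0// mulr_gt0.
  pose w := gradA (sc_step E 1 (c true r)) - gradA (sc_step E 1 (c false r))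
    - t *: D (sc_step E 1 eta).
  have wt : `|w| <= e / M * t.
    have -> : w = (gradA (sc_step E 1 (c true r)) - gradA (sc_step E 1 x)
        - D (sc_step E 1 (h true))) - (gradA (sc_step E 1 (c false r))
        - gradA (sc_step E 1 x) - D (sc_step E 1 (h false))).
      rewrite [in RHS]opprD [in RHS]addrACA -opprD -h12; congr (_ - _).
      by rewrite opprB subrKA.
    rewrite (le_trans (ler_normB _ _))// (le_trans (lerD (H1 true) (H1 false)))//.
    rewrite -mulrDr -mulrDr invfM mulrA.
    rewrite [leLHS](_ : _ = e / M * t * ((`|xi| + `|eta| + (`|xi| + 0)) / N)); last by ring.
    rewrite ler_piMr ?mulr_ge0 ?invr_ge0 ?(ltW e0) ?(ltW t0) ?(ltW M0)//.
    by rewrite ler_pdivrMr// mul1r /N; lra.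
  rewrite (_ : _ - _ = t * sc_inner E 0 w (sc_incl xi)); last first.
    by rewrite /w [in RHS]sc_innerBl sc_innerZl /q; ring.
  rewrite normrM (gtr0_norm t0).
  rewrite (le_trans (ler_wpM2l (ltW t0) (sc_cauchy_schwarz _ _)))//.
  rewrite [leRHS](_ : _ = t * (e * t)); last by rewrite /cst; ring.
  rewrite ler_wpM2l ?(ltW t0)// (le_trans (ler_wpM2r (normr_ge0 _) wt))//.
  rewrite [leLHS](_ : _ = e * t * (`|@sc_incl R E 2 xi| / M)); last by ring.
  rewrite ler_piMr ?mulr_ge0 ?(ltW e0) ?(ltW t0)//.
  by rewrite ler_pdivrMr// mul1r lerDl.
rewrite mul1r mul0r subr0; congr (`|_| <= _).
rewrite /phi /c !mul1r !mul0r !scale0r !add0r !addr0 subr0 !addrA.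
ring.
Unshelve. all: by end_near. Qed.

(** The second difference is symmetric in its two directions. *)
Lemma hessian_symmetric (x xi eta : E 2%N) : U (sc_incl x) ->
  sc_inner E 0 (@scD R (scShift E) E gradA x (sc_step E 1 xi)) (sc_incl eta) =
  sc_inner E 0 (@scD R (scShift E) E gradA x (sc_step E 1 eta)) (sc_incl xi).
Proof.
move=> Ux; set a := LHS; set b := RHS.
apply/eqP; rewrite -subr_eq0 -normr_eq0; apply/eqP/le_anti.
rewrite normr_ge0 andbT; apply/ler_addgt0Pl => e e0; rewrite addr0.
have e2 : 0 < e / 2 by rewrite divr_gt0.
have [d1 d10 H1] := second_difference_littleo eta xi Ux e2.
have [d2 d20 H2] := second_difference_littleo xi eta Ux e2.
pose t := Num.min d1 d2 / 2.
have m0 : 0 < Num.min d1 d2 by rewrite lt_min d10.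
have t0 : 0 < t by rewrite divr_gt0.
have tm : t < Num.min d1 d2 by rewrite ltr_pdivrMr// ltr_pMr// ltr1n.
have := H1 t; have := H2 t; rewrite t0; move: tm; rewrite lt_min => /andP[-> ->].
move=> /(_ isT) + /(_ isT); rewrite -/a -/b.
rewrite [x + t *: eta + t *: xi]addrAC.
move: (A _) (A _) (A _) (A _) => p1 p2 p3 p4.
have t20 : 0 < t ^+ 2 by rewrite exprn_gt0.
rewrite !ler_norml => /andP[? ?] /andP[? ?].
by rewrite -(ler_pM2l t20); apply/andP; split; nra.
Qed.

End hessian.

(** * Interpolation between the levels *)

Section interpolation.
Context {R : realType} (E : scHilbert R).

Definition sc_infty : set (E 0%N) := [set v | forall k, sc_mem k v].

Lemma sc_inftyB v w : sc_infty v -> sc_infty w -> sc_infty (v - w).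
Proof.
move=> vi wi k; exists (sc_lift k v - sc_lift k w) => //.
by rewrite sc_inclB !sc_liftK.
Qed.

Lemma sc_liftB k (v w : E 0%N) : sc_mem k v -> sc_mem k w ->
  sc_lift k (v - w) = sc_lift k v - sc_lift k w.
Proof.
by move=> [v' _ <-] [w' _ <-]; rewrite -sc_inclB !sc_inclK.
Qed.

Variable H : {linear E 1%N -> E 0%N}.
Hypothesis H_iso : forall k, restricts_to_iso H k.
Hypothesis H_sym : forall v w : E 2%N,
  sc_inner E 0 (H (sc_step E 1 v)) (sc_incl w) =
  sc_inner E 0 (H (sc_step E 1 w)) (sc_incl v).

(** [H] as an unbounded operator on $E_0$, meaningful on $E_1$ *)
Definition unbounded (v : E 0%N) : E 0%N := H (sc_lift 1 v).

Lemma unbounded_norms k : exists2 c : R, 0 < c & forall v, sc_infty v ->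
  [/\ sc_mem k (unbounded v),
    `|sc_lift k.+1 v| <= c * `|sc_lift k (unbounded v)| &
    `|sc_lift k (unbounded v)| <= c * `|sc_lift k.+1 v|].
Proof.
have [T [S [HT cT cS TS ST]]] := H_iso k.
have [c1 c10 H1] := linear_inverse_bound cS TS ST.
have [c2 c20 H2] := linear_bound cT.
exists (Num.max c1 c2); first by rewrite lt_max c10.
move=> v vi; have E1 : unbounded v = sc_incl (T (sc_lift k.+1 v)).
  rewrite HT /unbounded; congr (H _); apply: (@sc_incl_inj R E 1).
  rewrite sc_liftK//; have := @sc_incl_shift R E k (sc_lift k.+1 v).
  by rewrite sc_liftK.
rewrite E1 sc_inclK; split; first by eexists.
  by rewrite (le_trans (H1 _))// ler_wpM2r// le_max lexx.
by rewrite (le_trans (H2 _))// ler_wpM2r// le_max lexx orbT.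
Qed.

Lemma unbounded_infty v : sc_infty v -> sc_infty (unbounded v).
Proof. by move=> vi k; have [c _ /(_ v vi)[]] := unbounded_norms k. Qed.

Lemma iter_unbounded_infty j v : sc_infty v -> sc_infty (iter j unbounded v).
Proof. by move=> vi; elim: j => [//|j IH] /=; exact: unbounded_infty. Qed.

Lemma unbounded_sym v w : sc_infty v -> sc_infty w ->
  sc_inner E 0 (unbounded v) w = sc_inner E 0 v (unbounded w).
Proof.
move=> vi wi; have := H_sym (sc_lift 2 v) (sc_lift 2 w).
by rewrite !sc_lift_step// !sc_liftK// => ->; rewrite sc_innerC.
Qed.

Lemma iter_unbounded_sym j v w : sc_infty v -> sc_infty w ->
  sc_inner E 0 (iter j unbounded v) w = sc_inner E 0 v (iter j unbounded w).
Proof.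
move=> vi; elim: j w => [//|j IH] w wi; rewrite iterS unbounded_sym//.
  by rewrite IH -?iterSr//; exact: unbounded_infty.
exact: iter_unbounded_infty.
Qed.

Lemma iter_unbounded_norms j : exists2 c : R, 0 < c & forall v, sc_infty v ->
  `|sc_lift j v| <= c * `|iter j unbounded v| /\
  `|iter j unbounded v| <= c * `|sc_lift j v|.
Proof.
elim: j => [|j [c c0 IH]].
  by exists 1 => // v vi; rewrite sc_lift0 mul1r.
have [d d0 Hd] := unbounded_norms j; exists (d * c); first exact: mulr_gt0.
move=> v vi; have [_ H1 H2] := Hd v vi.
have [I1 I2] := IH _ (unbounded_infty vi).
rewrite iterSr; split; rewrite -mulrA.
  by rewrite (le_trans H1)// ler_pM2l.
by rewrite (le_trans I2)// mulrCA ler_pM2l.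
Qed.

(** Up to equivalence the norm of level [j] is $v\mapsto\|H^j v\|_0$, and
    $\|H^jv\|_0^2=\langle v,H^{2j}v\rangle$ as [H] is symmetric. *)
Lemma sc_interpolation j : exists2 c : R, 0 < c & forall v, sc_infty v ->
  `|sc_lift j v| ^+ 2 <= c * (`|v| * `|sc_lift (j + j) v|).
Proof.
have [c c0 Hc] := iter_unbounded_norms j.
have [d d0 Hd] := iter_unbounded_norms (j + j).
exists (c ^+ 2 * d); first by rewrite mulr_gt0// exprn_gt0.
move=> v vi; have [H1 _] := Hc v vi; have [_ H2] := Hd v vi.
rewrite (@le_trans _ _ ((c * `|iter j unbounded v|) ^+ 2))//.
  by rewrite ler_sqr ?nnegrE ?mulr_ge0 ?(ltW c0).
rewrite exprMn -mulrA ler_pM2l ?exprn_gt0// -sc_inner_norm.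
rewrite iter_unbounded_sym//; last exact: iter_unbounded_infty.
rewrite -iterD (le_trans (ler_norm _))// (le_trans (sc_cauchy_schwarz _ _))//.
by rewrite mulrCA ler_wpM2l.
Qed.

End interpolation.

(** * Gradient flow lines *)

Section gradient_flow.
Context {R : realType} (E : scHilbert R).
Variables (U : set (E 0%N)) (A : E 1%N -> R) (gradA : E 1%N -> E 0%N).
Hypothesis openU : open U.
Hypothesis hA : sc_action_functional U A gradA.
Variable x : R -> E 0%N.
Hypothesis hx : sc_gradient_flow_line U gradA x.

Definition level_curve k (s : R) : E k := sc_lift k (x s).
Local Notation Y := level_curve.

Lemma level_curve_smooth : sc_smooth_curve Y.
Proof.
have [xs _ _] := hx.
apply: (@sc_smooth_comp_curve R (scConst (R := R)) E setT x (fun=> id)) => //.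
  exact: openT.
split=> // m k s; have := @affine_derivable R 1 0 m s.
by under eq_fun do rewrite mul1r addr0.
Qed.

Lemma flow_infty s : sc_infty (x s).
Proof.
have [xs _ _] := hx => k; have := (xs 0%N k).1 s.
by rewrite (_ : @sc_incl R (scConst (R := R)) k s = s)//; [exact|elim: k].
Qed.

Lemma level_curve0 s : Y 0 s = x s.
Proof. exact: sc_lift0. Qed.

Lemma sc_incl_level_curve k s : sc_incl (Y k s) = x s.
Proof. by rewrite sc_liftK//; exact: flow_infty. Qed.

Lemma flow_equation s : curve_derive Y 0 s = - gradA (Y 1 s).
Proof.
have [xs _ <-] := hx; have [_ dx _] := xs 1%N.
have dx1 : is_derive s 1 (Y 0) (@scD R (scConst (R := R)) E x s 1).
  rewrite (_ : Y 0 = fun t => x t); last exact/funext/level_curve0.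
  exact: (@is_derive_scD0 R (scConst (R := R)) E setT x id s 1 dx I).
exact: is_derive_derive1.
Qed.

Lemma action_along_flow (s : R) :
  is_derive s 1 (fun t => A (Y 1 t)) (- energy gradA (Y 1 s)).
Proof.
have sY := level_curve_smooth.
have Us : U (sc_incl (Y 2 s)).
  by rewrite sc_incl_level_curve; have [_ xU _] := hx.
have := action_is_derive hA Us (curve_is_derive sY 2 s).
rewrite (curve_incl (curve_derive_smooth sY)) flow_equation sc_innerNr sY.1.
by under eq_fun do rewrite sY.1.
Qed.

Lemma energy_velocity s : energy gradA (Y 1 s) = `|curve_derive Y 0 s| ^+ 2.
Proof. by rewrite /energy sc_inner_norm flow_equation normrN. Qed.

Variable xp : E 0%N.
Hypothesis hxp : Crit U A xp.
Hypothesis hlim : sc_infty_cvg x xp.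

Lemma crit_grad : gradA (sc_lift 1 xp) = 0.
Proof.
have [Uxp xpi dA0] := hxp; have [_ [_ Ag]] := hA.
apply: (@sc_inner_dense R E) => xi; rewrite -(sc_lift_step (xpi 2%N)).
by rewrite Ag ?dA0// sc_liftK.
Qed.

Lemma action_cvg : (fun s => A (Y 1 s)) @ +oo --> A (sc_lift 1 xp).
Proof.
have [As _] := hA; have [Uxp xpi _] := hxp.
have [_] := (As 0%N) 0%N.
rewrite continuous_open_subspace; last exact: (@open_scdom R E 1).
move=> /(_ (sc_lift 1 xp)).
have -> : (fun x0 : E 1%N => @sc_lift R (scConst (R := R)) 0 (A x0)) = A.
  by apply/funext => y; exact: (@sc_lift0 R (scConst (R := R))).
have /mem_set Ux1 : [set y : E 1%N | U (sc_incl y)] (sc_lift 1 xp).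
  by rewrite /mkset (sc_liftK (xpi 1%N)).
move=> /(_ Ux1) cA.
exact: (@cvg_comp_at R R (E 1%N) R _ _ A (Y 1) (sc_lift 1 xp) cA (@hlim 1%N)).
Qed.

Variable kappa : R.
Hypothesis hkappa : action_energy_constant U A gradA xp kappa.

Local Notation f := (fun s => A (Y 1 s) - A (sc_lift 1 xp)).

(** The gap decreases along the flow and tends to 0. *)
Lemma action_gap_ge0 s : 0 <= f s.
Proof.
rewrite subr_ge0 leNgt; apply/negP => lt.
have : \forall t \near +oo, A (Y 1 s) < A (Y 1 t).
  by move: action_cvg => /cvgr_gt; apply.
move=> [M [_ HM]].
have := HM (Num.max (M + 1) s); rewrite lt_max ltrDl ltr01 => /(_ isT).
apply/negP; rewrite -leNgt.
apply: (@le0_derive_nonincreasing R (fun t => A (Y 1 t))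
  (fun t => - energy gradA (Y 1 t))).
- by rewrite le_max lexx orbT.
- by move=> t _; exact: action_along_flow.
- by move=> t _; rewrite oppr_le0 energy_velocity sqr_ge0.
Qed.

Lemma action_gap_energy : exists S, forall s, S <= s ->
  kappa * f s <= `|curve_derive Y 0 s| ^+ 2.
Proof.
have [k0 [eps eps0 He]] := hkappa; have [_ xU _] := hx.
have : \forall s \near +oo, `|sc_lift 10 xp - Y 10 s| < eps.
  by have /cvgrPdist_lt/(_ _ eps0) := @hlim 10.
move=> [M [_ HM]]; exists (M + 1) => s Ms.
have {Ms} Ms : M < s by rewrite (lt_le_trans _ Ms)// ltrDl.
have := He (Y 10 s); rewrite sc_incl_level_curve distrC => /(_ (xU s) (HM s Ms)).
have E1 : @sc_incl R (scShift E) 9 (Y 10 s) = Y 1 s.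
  exact: (curve_incl_shift level_curve_smooth 9).
rewrite /= -[X in A X]/(@sc_incl R (scShift E) 9 (Y 10 s)).
rewrite -[X in energy _ X]/(@sc_incl R (scShift E) 9 (Y 10 s)) E1 => H.
by rewrite -energy_velocity mulrC -ler_pdivlMr// (le_trans (ler_norm _)).
Qed.

Lemma action_gap_is_derive (t : R) : is_derive t 1 f (- energy gradA (Y 1 t)).
Proof.
rewrite -[X in is_derive _ _ _ X]subr0.
by apply: is_deriveB; exact: action_along_flow.
Qed.

(** Gronwall: $f e^{\kappa s}$ is eventually nonincreasing. *)
Lemma action_gap_decay : exists2 C, 0 < C & exists S, forall s, S <= s ->
  f s <= C * expR (- kappa * s).
Proof.
have [S HS] := action_gap_energy.
exists (`|f S * expR (kappa * S)| + 1); first by rewrite ltr_wpDl.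
exists S => s Ss; rewrite mulNr expRN -ler_pdivrMr ?invr_gt0 ?expR_gt0// invrK.
rewrite (@le_trans _ _ (f S * expR (kappa * S)))//; last first.
  by rewrite ler_wpDr// ler_norm.
apply: (@le0_derive_nonincreasing R (fun t => f t * expR (kappa * t))
  (fun t => f t * (kappa * expR (kappa * t)) +
    expR (kappa * t) * - energy gradA (Y 1 t))) => // t /andP[St _].
  apply: is_deriveM; last exact: is_derive_expRM.
  exact: action_gap_is_derive.
rewrite mulrCA mulrA mulrC -mulrDr pmulr_rle0 ?expR_gt0// subr_le0.
by rewrite energy_velocity; exact: HS.
Qed.

(** With $h=f+e^{-\kappa s}>0$ in place of the action gap $f$, which may vanish, the
    function $g=\sqrt h$ is differentiable and $g'\le-\frac{\sqrt\kappa}2\|x'\|_0$: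
    the decrease of $g$ pays for the length of the trajectory. *)
Lemma velocity_controlled : exists2 c : R, 0 < c &
  exists S : R, exists dg : R -> R, forall t : R, S <= t ->
    is_derive t 1 (fun t => c * Num.sqrt (f t + expR (- kappa * t))) (- dg t) /\
    `|curve_derive Y 0 t| <= dg t.
Proof.
have [k0 _] := hkappa; have [S HS] := action_gap_energy.
pose h (t : R) := f t + expR (- kappa * t).
have h0 t : 0 < h t by rewrite ltr_wpDl ?expR_gt0// action_gap_ge0.
have q0 : 0 < Num.sqrt kappa by rewrite sqrtr_gt0.
exists (2 / Num.sqrt kappa); first by rewrite divr_gt0.
exists S, (fun t => (energy gradA (Y 1 t) + kappa * expR (- kappa * t)) /
  (Num.sqrt kappa * Num.sqrt (h t))) => t St.
have g0 : 0 < Num.sqrt (h t) by rewrite sqrtr_gt0.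
split.
  have Dh : is_derive t 1 h (- energy gradA (Y 1 t) + - kappa * expR (- kappa * t)).
    apply: is_deriveD; last exact: is_derive_expRM.
    exact: action_gap_is_derive.
  have := is_deriveZ (2 / Num.sqrt kappa) (is_derive_sqrt (h0 t) Dh).
  move=> Dg; apply: (is_derive_eq Dg); rewrite /GRing.scale/=; field.
  by rewrite !gt_eqF.
have p0 : 0 < Num.sqrt kappa * Num.sqrt (h t) by rewrite mulr_gt0.
rewrite ler_pdivlMr// energy_velocity.
have p2 : (Num.sqrt kappa * Num.sqrt (h t)) ^+ 2 <=
    `|curve_derive Y 0 t| ^+ 2 + kappa * expR (- kappa * t).
  by rewrite exprMn !sqr_sqrtr ?(ltW k0) ?(ltW (h0 t))// /h mulrDr lerD2r HS.
have := mulr_gt0 k0 (expR_gt0 (- kappa * t)).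
move: (normr_ge0 (curve_derive Y 0 t)) p0 p2.
move: `|_| (_ * Num.sqrt _) (kappa * expR _) => n p m n0 p0 p2 m0.
by have := sqr_ge0 (n - p); nra.
Qed.

(** Integrating [velocity_controlled] over $[s,t]$ and letting $t\to\infty$. *)
Lemma flow_decay_bottom : exp_decay (kappa / 2) (fun s => Y 0 s - sc_lift 0 xp).
Proof.
have [C C0 [S1 HC]] := action_gap_decay.
have [c c0 [S2 [dg Hg]]] := velocity_controlled.
apply: (@exp_decay_eventually _ _ _ _ (c * Num.sqrt (C + 1)) (Num.max S1 S2)).
  move=> s; apply: cvgB; last exact: cvg_cst.
  exact: is_derive_continuous (curve_is_derive level_curve_smooth 0 s).
move=> s; rewrite ge_max => /andP[S1s S2s].
pose g (t : R) := c * Num.sqrt (f t + expR (- kappa * t)).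
have gs : g s <= c * Num.sqrt (C + 1) * expR (- (kappa / 2) * s).
  have <- : Num.sqrt (expR (- kappa * s)) = expR (- (kappa / 2) * s).
    rewrite (_ : expR (- kappa * s) = expR (- (kappa / 2) * s) ^+ 2).
      by rewrite sqrtr_sqr gtr0_norm ?expR_gt0.
    by rewrite -expRM_natl; congr expR; field.
  rewrite -mulrA ler_pM2l// -sqrtrM; last by rewrite addr_ge0 ?(ltW C0).
  by apply: ler_wsqrtr; rewrite mulrDl mul1r lerD2r HC.
apply: le_trans gs; apply/ler_addgt0Pr => e e0.
have [M [_ HM]] : \forall t \near +oo, `|sc_lift 0 xp - Y 0 t| < e.
  by have /cvgrPdist_lt/(_ _ e0) := @hlim 0%N.
pose t := Num.max (M + 1) s.
have Mt : M < t by rewrite lt_max ltrDl ltr01.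
have st : s <= t by rewrite le_max lexx orbT.
have : `|Y 0 t - Y 0 s| <= (- g) t - (- g) s.
  apply: (@mean_value_inequality R _ _ (curve_derive Y 0) (- g) dg) => // u /andP[su _].
  - exact: curve_is_derive level_curve_smooth 0 u.
  - rewrite -[dg u]opprK; apply: is_deriveN.
    by have [] := Hg u (le_trans S2s su).
  - by have [] := Hg u (le_trans S2s su).
rewrite opprK [(- g) t]/(- g t) => H.
have gt0 : 0 <= g t by rewrite mulr_ge0 ?(ltW c0)// sqrtr_ge0.
rewrite distrC -(subrK (Y 0 t) (sc_lift 0 xp)) -addrA.
apply: le_trans (ler_normD _ _) _; rewrite [leLHS]addrC.
apply: lerD; last exact: ltW (HM t Mt).
by rewrite (le_trans H)// addrC lerBlDr lerDl.
Qed.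

Hypothesis hMorse : sc_Morse U A gradA.

(** Interpolating between the decay at level 0 and a rate [r] valid at all levels
    improves the latter to the mean of the two rates. *)
Lemma rate_improves (r : R) :
  (forall j, exp_decay r (fun s => Y j s - sc_lift j xp)) ->
  forall j, exp_decay ((kappa / 2 + r) / 2) (fun s => Y j s - sc_lift j xp).
Proof.
move=> Yr j; have [Uxp xpi _] := hxp.
have Hsym : forall v w : E 2%N,
    sc_inner E 0 (hessian gradA xp (sc_step E 1 v)) (sc_incl w) =
    sc_inner E 0 (hessian gradA xp (sc_step E 1 w)) (sc_incl v).
  move=> v w; apply: (hessian_symmetric openU hA).
  by rewrite (@sc_liftK R E 2).
have [c c0 Hc] := sc_interpolation (hMorse hxp) Hsym j.
apply: exp_decay_mean c0 _ flow_decay_bottom (Yr (j + j)%N) => s s0.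
have := Hc _ (sc_inftyB (flow_infty s) xpi).
rewrite !sc_liftB//; try exact: flow_infty.
by rewrite -[x s - xp]sc_lift0 sc_liftB//; exact: flow_infty.
Qed.

Lemma flow_decay_levels (mu : R) : mu < kappa / 3 ->
  forall j, exp_decay mu (fun s => Y j s - sc_lift j xp).
Proof.
move=> muk; have [k0 _] := hkappa.
(* rate 0 is boundedness, which convergence gives at each level *)
have Y0 : forall j, exp_decay 0 (fun s => Y j s - sc_lift j xp).
  move=> j; have /cvgrPdist_le/(_ _ ltr01)[M [_ HM]] := @hlim j.
  apply: (@exp_decay_eventually _ _ _ _ 1 (M + 1)).
    move=> s; apply: cvgB; last exact: cvg_cst.
    exact: is_derive_continuous (curve_is_derive level_curve_smooth j s).
  move=> s Ms; rewrite oppr0 mul0r expR0 mul1r distrC; apply: HM.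
  by rewrite (lt_le_trans _ Ms)// ltrDl.
(* the rates are 0, kappa/4 and 3 kappa/8 *)
move=> j; have [C C0 HC] := rate_improves (rate_improves Y0) j.
exists C => // s s0; rewrite (le_trans (HC s s0))// ler_pM2l// ler_expR.
by rewrite ler_wpM2r// lerN2; lra.
Qed.

Lemma gradient_flow_is_flow : @flow R (scShift E) E (scdom_shift U) gradA
  (fun k => Y k.+1) Y (fun k => sc_lift k.+1 xp).
Proof.
have sY := level_curve_smooth; have [_ xU _] := hx; have [_ [gs _]] := hA.
have [Uxp xpi _] := hxp; split=> //.
- exact: (@open_scdom R E 1).
- by split=> [k s|m k s]; [exact: sY.1|exact: sY.2].
- by move=> s; rewrite /scdom_shift/mkset (sc_incl_level_curve 1).
- exact: flow_equation.
- by move=> k; exact: (sc_lift_step (xpi k.+2)).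
- by rewrite /scdom_shift/mkset (sc_liftK (xpi 1%N)).
- exact: crit_grad.
Qed.

Lemma flow_derivative_decay (mu : R) m j : 0 < mu < kappa / 3 ->
  exp_decay mu (derive1n m.+1 (Y j)).
Proof.
move=> /andP[mu0 muk]; apply: (flow_decay _ _ mu0 gradient_flow_is_flow) => k.
exact: flow_decay_levels.
Qed.

End gradient_flow.

Theorem theorem3p1 (R : realType) (E : scHilbert R)
    (U : set (E 0%N)) (openU : open U)
    (A : E 1%N -> R) (gradA : E 1%N -> E 0%N)
    (hA : sc_action_functional U A gradA)
    (hMorse : sc_Morse U A gradA)
    (x : R -> E 0%N) (hx : sc_gradient_flow_line U gradA x)
    (xp : E 0%N) (hxp : Crit U A xp) (hlim : sc_infty_cvg x xp)
    (kappa : R) (hkappa : action_energy_constant U A gradA xp kappa)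
    (kappa' : R) (kappa'_gt0 : 0 < kappa') (hkappa' : kappa' < kappa / 3) :
  exists C : nat -> nat -> R,
    [/\ forall j m, 0 < C j m,
        forall j (s : R), 0 <= s ->
          sc_norm_le j (x s - xp) (C j 0%N * expR (- kappa' * s)) &
        forall j m (s : R), 0 <= s -> (1 <= m)%N ->
          sc_norm_le j (derive1n m x s) (C j m * expR (- kappa' * s))].
Proof.
have sY := level_curve_smooth hx.
have xE : level_curve x 0 = x by apply/funext => s; exact: level_curve0.
have xpi : sc_infty xp by have [_ ? _] := hxp.
have decay0 j : exists2 c : R, 0 < c & forall s, 0 <= s ->
    sc_norm_le j (x s - xp) (c * expR (- kappa' * s)).
  have [c c0 Hc] := flow_decay_levels openU hA hx hxp hlim hkappa hMorse hkappa' j.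
  exists c => // s s0; exists (level_curve x j s - sc_lift j xp); last exact: Hc.
  by rewrite sc_inclB (sc_incl_level_curve hx) sc_liftK.
have decayS j m : exists2 c : R, 0 < c & forall s, 0 <= s ->
    sc_norm_le j (derive1n m.+1 x s) (c * expR (- kappa' * s)).
  have k' : 0 < kappa' < kappa / 3 by rewrite kappa'_gt0.
  have [c c0 Hc] := flow_derivative_decay openU hA hx hxp hlim hkappa hMorse m j k'.
  exists c => // s s0; exists (derive1n m.+1 (level_curve x j) s); last exact: Hc.
  by rewrite (curve_incl_derive1n sY) xE.
pose C j m := if m is m'.+1 then sval (cid2 (decayS j m'))
              else sval (cid2 (decay0 j)).
exists C; split=> [j [|m]|j s s0|j [//|m] s s0 _]; rewrite /C.
- by case: cid2.
- by case: cid2.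
- by case: cid2 => c /= _; exact.
- by case: cid2 => c /= _; exact.
Qed.
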